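(* Let $\mathcal G$ be a core input-output network with homeostasis pattern network $\mathcal P$, structural pattern network $\mathcal P_{\mathcal S}$ and appendage pattern network $\mathcal P_{\mathcal A}$. An appendage component $\widetilde{\mathcal A}\in\mathcal P_{\mathcal A}$ induces every super-simple node of $\mathcal P_{\mathcal S}$ downstream from $\mathcal V_{max}(\widetilde{\mathcal A})$, but no other super-simple nodes. Further, an appendage component $\widetilde{\mathcal A}\in\mathcal P_{\mathcal A}$ induces a backbone node $\widetilde{\mathcal L}_j$ if and only if $\widetilde{\mathcal L}_j$ is strictly downstream from $\mathcal V_{max}(\widetilde{\mathcal A})$.
   Context: NETWORKS. An input-output network $\mathcal G$ is a finite directed graph with two distinct distinguished nodes, the input node $\iota$ and the output node $o$. It is core if every node is downstream from $\iota$ (there is a directed path from $\iota$ to it) and upstream from $o$. INDUCTION. Each node $j$ carries a variable $x_j\in\mathbb R$. An admissible system is $\dot X=f(X,\mathcal I)$ with $f$ smooth, where the real parameter $\mathcal I$ appears only in $f_\iota$, and $f_j$ depends only on $x_j$ and on those $x_\ell$ with an arrow $\ell\to j$. Write $f_{j,\ell}=\partial f_j/\partial x_\ell$; for $j\ne\ell$, $f_{j,\ell}\equiv 0$ precisely when there is no arrow $\ell\to j$. If $X_0$ is a hyperbolic equilibrium at $\mathcal I_0$, there is a unique family of equilibria $X(\mathcal I)$ near $\mathcal I_0$ with $X(\mathcal I_0)=X_0$; a node $\kappa$ is homeostatic at $(X_0,\mathcal I_0)$ if $x_\kappa'(\mathcal I_0)=0$. The homeostasis matrix $H$ is the Jacobian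 $J=(f_{j,\ell})$ with the row of $\iota$ and the column of $o$ deleted. There are permutation matrices $P,Q$ such that $PHQ$ is block upper triangular with square diagonal blocks $B_1,\dots,B_m$ that cannot be further block triangularized (entries $f_{j,\ell}$ regarded as independent indeterminates); these are the homeostasis blocks. The homeostasis subnetwork $\mathcal K_\eta$ of $B_\eta$ has as nodes all $p,q$ such that $f_{p,q}$ is a nonzero entry of $B_\eta$, and as arrows the corresponding $q\to p$ with $p\ne q$. $\mathcal K_\eta$ is homeostasis inducing at $(X_0,\mathcal I_0)$ if $\det B_\eta=0$ there. $\mathcal K\Rightarrow\kappa$ ($\mathcal K$ induces node $\kappa$) means: generically for admissible $f$, $\kappa$ is homeostatic whenever $\mathcal K$ is homeostasis inducing. Here ''generically'' means: except when the partial derivatives at $(X_0,\mathcal I_0)$ satisfy an additional polynomial equation not vanishing identically on the set where the determinant of the block of $\mathcal K$ is zero. For a set $\mathcal N$ of nodes (or a subnetwork), $\mathcal K\Rightarrow\mathcal N$ means $\mathcal K\Rightarrow\kappa$ for every $\kappa\in\mathcal N$. SIMPLE NODES. A simple path visits each of its nodes once; $\kappa_1\rightsquigarrow\kappa_2$ denotes a simple path from $\kappa_1$ to $\kappa_2$. An $\iota o$-simple path is a simple path from $\iota$ to $o$. A node is simple if it lies on some $\iota o$-simple path, appendage otherwise, and super-simple if it lies on every $\iota o$-simple path. The super-simple nodes are totally ordered, $\iota=\rho_0\prec\rho_1\prec\dots\prec\rho_{q+1}=o$, by order of appearance on any $\iota o$-simple path. If there are a super-simple $\rho$ and an $\iota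 o$-simple path $\iota\rightsquigarrow\sigma_1\rightsquigarrow\rho\rightsquigarrow\sigma_2\rightsquigarrow o$, then $\sigma_1\prec\rho$, $\rho\prec\sigma_2$, $\sigma_1\prec\sigma_2$. A transitive component is a strongly connected component. For an $\iota o$-simple path $S$, the complementary subnetwork $C_S$ consists of all nodes not in $S$ and all arrows between them. An appendage node $\tau$ is super-appendage if for each $C_S$ containing $\tau$, the transitive component of $\tau$ in $C_S$ consists only of appendage nodes. SUBNETWORKS. For $1\le j\le q+1$: the simple subnetwork $\mathcal L_j''$ consists of the simple nodes $\sigma$ with $\rho_{j-1}\prec\sigma\prec\rho_j$ (possibly none); $T_j$ is the set of appendage, non-super-appendage nodes $\tau$ linked to $\mathcal L_j''$, i.e. such that for some $C_S$ the transitive component of $\tau$ in $C_S$ is the union of $\tau$, (at least one) nodes of $\mathcal L_j''$, and non-super-appendage nodes; the augmented simple subnetwork is $\mathcal L_j'=\mathcal L_j''\cup T_j$; the structural subnetwork is $\mathcal L_j=\{\rho_{j-1}\}\cup\mathcal L_j'\cup\{\rho_j\}$, each with all arrows between its nodes. An appendage subnetwork $\mathcal A$ is a transitive component of the subnetwork of super-appendage nodes. It is known that the homeostasis subnetworks of $\mathcal G$ are the structural and the appendage subnetworks. PATTERN NETWORK. $\mathcal P_{\mathcal S}$ is the chain $\iota=\rho_0\to\widetilde{\mathcal L}_1\to\rho_1\to\dots\to\widetilde{\mathcal L}_{q+1}\to\rho_{q+1}=o$, whose nodes are the super-simple nodes and the backbone nodes $\widetilde{\mathcal L}_j$ (representing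 $\mathcal L_j'$ as a single node, even if empty). $\mathcal P_{\mathcal A}$ has one node $\widetilde{\mathcal A}$ (appendage component) for each appendage subnetwork $\mathcal A$, and an arrow $\widetilde{\mathcal A}_1\to\widetilde{\mathcal A}_2$ between distinct nodes iff $\tau_1\to\tau_2$ in $\mathcal G$ for some $\tau_1\in\mathcal A_1,\tau_2\in\mathcal A_2$. An appendage path is a simple path containing an appendage node, all of whose nodes except perhaps the endpoints are appendage. $\mathcal V_{max}(\widetilde{\mathcal A})$ is the most downstream node $\mathcal V$ of $\mathcal P_{\mathcal S}$ such that there is an appendage path from some $\tau\in\mathcal A$ to some simple node $\sigma\in\mathcal V$; $\mathcal V_{min}(\widetilde{\mathcal A})$ is the most upstream node $\mathcal V$ of $\mathcal P_{\mathcal S}$ such that there is an appendage path from some simple node $\sigma\in\mathcal V$ to some $\tau\in\mathcal A$. The homeostasis pattern network $\mathcal P$ consists of the nodes and arrows of $\mathcal P_{\mathcal S}$ and $\mathcal P_{\mathcal A}$ together with the arrows $\widetilde{\mathcal A}\to\mathcal V_{max}(\widetilde{\mathcal A})$ and $\mathcal V_{min}(\widetilde{\mathcal A})\to\widetilde{\mathcal A}$ for each $\widetilde{\mathcal A}$. ''Strictly downstream'' in $\mathcal P_{\mathcal S}$ means strictly later in the chain; ''downstream'' (without ''strictly'') allows equality. The homeostasis subnetworks corresponding to $\widetilde{\mathcal L}_j$ and $\widetilde{\mathcal A}$ are $\mathcal L_j$ and $\mathcal A$. An appendage component $\widetilde{\mathcal A}$ induces a backbone node $\widetilde{\mathcal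 L}_j$ iff $\mathcal A\Rightarrow\mathcal L_j$, and induces a super-simple node $\rho$ iff $\mathcal A\Rightarrow\rho$. *)

(* Defs.v *)
From HB Require Import structures.
From mathcomp Require Import all_boot all_order all_algebra perm.
From mathcomp Require Import all_classical all_reals all_analysis.
From mathcomp Require mpoly.
From mathcomp Require Import -(notations) complex.

Set Implicit Arguments.
Unset Strict Implicit.
Unset Printing Implicit Defensive.

Import Order.TTheory GRing.Theory Num.Theory.
Import numFieldNormedType.Exports.

Local Open Scope ring_scope.

(* The nodes of a network are numbered by ['I_n], so that states are row      *)
(* vectors and Jacobians are matrices.  [arrow G x y] is an arrow x -> y.     *)
(* Loops [arrow G x x] are not excluded but carry no information: every node  *)
(* function may depend on its own variable anyway, and no definition below    *)
(* distinguishes networks that differ by loops.                               *)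
Record network (n : nat) := Network {
  arrow : rel 'I_n;
  inp : 'I_n;
  out : 'I_n;
  inp_neq_out : inp != out }.

Section Combinatorics.
Variables (n : nat) (G : network n).
Implicit Types (x y v : 'I_n) (s : seq 'I_n) (N : {set 'I_n}).

Definition core :=
  forall v, connect (arrow G) (inp G) v /\ connect (arrow G) v (out G).

(* [s] is the list of all nodes of the path, both endpoints included; the     *)
(* one-node path from x to x is allowed.                                      *)
Definition simple_path x y s : bool :=
  if s is a :: p then
    [&& a == x, path (arrow G) a p, last a p == y & uniq (a :: p)]
  else false.

Definition io_simple_path s : bool := simple_path (inp G) (out G) s.

Definition simple v : Prop := exists2 s, io_simple_path s & v \in s.
Definition appendage v : Prop := ~ simple v.
Definition super_simple v : Prop := forall s, io_simple_path s -> v \in s.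

(* The two nodes are separated by a super-simple node on some io-simple path; *)
(* that super-simple node may be x or y itself.                               *)
Definition prec x y : Prop :=
  x <> y /\
  exists s rho, [/\ io_simple_path s, super_simple rho,
    [/\ x \in s, rho \in s & y \in s] &
    (index x s <= index rho s <= index y s)%N].

(* rho_0, ..., rho_{q+1} in the order [prec]; the length of the list is q+2.  *)
Definition super_simple_nodes : seq 'I_n :=
  sort (fun x y => `[< x = y \/ prec x y >])
       [seq v <- enum 'I_n | `[< super_simple v >]].

Definition nb_super_simple : nat := size super_simple_nodes.
Definition rho (j : nat) : 'I_n := nth (inp G) super_simple_nodes j.

Definition restrict N : rel 'I_n :=
  [rel x y | [&& x \in N, y \in N & arrow G x y]].

(* For x in N, the strongly connected component of x in the subnetwork of all *)
(* nodes of N and all arrows between them.                                    *)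
Definition transitive_component N x : {set 'I_n} :=
  [set y | connect (restrict N) x y && connect (restrict N) y x]%SET.

Definition complementary s : {set 'I_n} := [set v | v \notin s]%SET.

Definition super_appendage v : Prop :=
  appendage v /\
  forall s, io_simple_path s -> v \in complementary s ->
  forall w, w \in transitive_component (complementary s) v -> appendage w.

(* Here and below the subscript j ranges over 1, ..., q+1.                    *)
Definition simple_subnetwork (j : nat) v : Prop :=
  [/\ simple v, prec (rho j.-1) v & prec v (rho j)].

Definition linked v (j : nat) : Prop :=
  exists s, [/\ io_simple_path s, v \in complementary s,
    exists2 w, w \in transitive_component (complementary s) v
             & simple_subnetwork j w &
    forall w, w \in transitive_component (complementary s) v ->
      [\/ w = v, simple_subnetwork j w
        | appendage w /\ ~ super_appendage w]].

Definition augmented_simple_subnetwork (j : nat) v : Prop :=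
  simple_subnetwork j v \/
  [/\ appendage v, ~ super_appendage v & linked v j].

Definition structural_subnetwork (j : nat) v : Prop :=
  [\/ v = rho j.-1, augmented_simple_subnetwork j v | v = rho j].

(* The nodes of P_A are the sets satisfying this predicate.                   *)
Definition appendage_subnetwork (A : {set 'I_n}) : Prop :=
  exists2 v, super_appendage v &
    A = transitive_component [set w | `[< super_appendage w >]]%SET v.

(* Nodes of P_S: [SuperSimple j] is rho_j (0 <= j <= q+1), [Backbone j] is    *)
(* the node representing L'_j (1 <= j <= q+1).                                *)
Inductive chain_node := SuperSimple of nat | Backbone of nat.

Definition structural_pattern : seq chain_node :=
  SuperSimple 0 ::
  flatten [seq [:: Backbone j; SuperSimple j]
          | j <- iota 1 nb_super_simple.-1].

Definition chain_position (V : chain_node) : nat :=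
  match V with SuperSimple j => j.*2 | Backbone j => j.*2.-1 end.

(* [downstream V W]: V is downstream from W.                                  *)
Definition downstream (V W : chain_node) : Prop :=
  (chain_position W <= chain_position V)%N.
Definition strictly_downstream (V W : chain_node) : Prop :=
  (chain_position W < chain_position V)%N.

Definition represented (V : chain_node) v : Prop :=
  match V with
  | SuperSimple j => v = rho j
  | Backbone j => augmented_simple_subnetwork j v
  end.

Definition appendage_path x y s : Prop :=
  [/\ simple_path x y s, exists2 v, v \in s & appendage v &
      forall v, v \in s -> v <> x -> v <> y -> appendage v].

Definition appendage_path_to (A : {set 'I_n}) (V : chain_node) : Prop :=
  exists x y s, [/\ x \in A, simple y, represented V y & appendage_path x y s].

(* The last node of the chain reached from A.  The default value is never     *)
(* used in a core network, where every appendage node is upstream from [out]. *)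
Definition Vmax (A : {set 'I_n}) : chain_node :=
  last (SuperSimple 0)
       [seq V <- structural_pattern | `[< appendage_path_to A V >]].

(* A subnetwork is given by its nodes and its arrows, an arrow q -> p being   *)
(* the pair (q, p).                                                           *)
Definition subnetwork := ({set 'I_n} * {set 'I_n * 'I_n})%type.

Definition full_subnetwork N : subnetwork :=
  (N, [set e | [&& e.1 \in N, e.2 \in N, e.1 != e.2 & arrow G e.1 e.2]]%SET).

(* f_{p,q} is not identically zero.                                           *)
Definition coupled (p q : 'I_n) : bool := (p == q) || arrow G q p.

(* Block triangularization of the homeostasis matrix H: [s] and [t] are the   *)
(* permutations of the rows and columns, so that P H Q has (i, j) entry       *)
(* H (s i) (t j), and [lev i] is the number of the diagonal block to which    *)
(* the position i belongs (rows and columns are cut at the same positions,    *)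
(* hence the diagonal blocks are square).                                     *)
Section Blocks.
Variables (s t : 'S_n.-1) (lev : 'I_n.-1 -> nat).

(* The nodes p, q such that the (i, j) entry of P H Q is f_{p,q}.             *)
Definition row_node (i : 'I_n.-1) : 'I_n := lift (inp G) (s i).
Definition col_node (j : 'I_n.-1) : 'I_n := lift (out G) (t j).
Definition entry_nz (i j : 'I_n.-1) : bool := coupled (row_node i) (col_node j).

Definition block_positions (eta : nat) : {set 'I_n.-1} :=
  [set i | lev i == eta]%SET.

Definition block_upper_triangular : Prop :=
  (forall i j : 'I_n.-1, (i <= j)%N -> (lev i <= lev j)%N) /\
  (forall i j : 'I_n.-1, (lev j < lev i)%N -> ~~ entry_nz i j).

(* No permutations of the rows and of the columns of the block [eta] put it   *)
(* in block upper triangular form with two square diagonal blocks.            *)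
Definition not_further_triangularizable (eta : nat) : Prop :=
  forall (s' t' : 'S_#|block_positions eta|) (c : nat),
    (0 < c < #|block_positions eta|)%N ->
  exists i j : 'I_#|block_positions eta|,
    [/\ (c <= i)%N, (j < c)%N & entry_nz (enum_val (s' i)) (enum_val (t' j))].

Definition homeostasis_blocks : Prop :=
  block_upper_triangular /\ forall eta, not_further_triangularizable eta.

Definition homeostasis_subnetwork (eta : nat) : subnetwork :=
  let D := block_positions eta in
  ([set v | [exists i in D, [exists j in D,
       entry_nz i j && ((v == row_node i) || (v == col_node j))]]]%SET,
   [set e | [exists i in D, [exists j in D,
       [&& entry_nz i j, row_node i != col_node j
         & e == (col_node j, row_node i)]]]]%SET).

End Blocks.
End Combinatorics.

Section Dynamics.
Variables (R : realType) (n : nat) (G : network n).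

Definition homeostasis_matrix (J : 'M[R]_n) : 'M[R]_n.-1 :=
  row' (inp G) (col' (out G) J).

Definition homeostasis_block (s t : 'S_n.-1) (lev : 'I_n.-1 -> nat) (eta : nat)
    (J : 'M[R]_n) : 'M[R]_#|block_positions lev eta| :=
  mxsub enum_val enum_val (row_perm s (col_perm t (homeostasis_matrix J))).

(* C^oo: all iterated directional derivatives exist and are differentiable.   *)
Definition smooth (U : normedModType R) (g : U -> R) : Prop :=
  forall (vs : seq U) (z : U),
    differentiable (foldr (fun v (h : U -> R) => 'D_v h) g vs) z.

(* A parametrized vector field: f X I is the right-hand side at state X and   *)
(* input I.                                                                   *)
Definition vector_field := 'rV[R]_n -> R -> 'rV[R]_n.

(* (j, l) entry: f_{j,l}.                                                     *)
Definition jac (f : vector_field) (X : 'rV[R]_n) (I : R) : 'M[R]_n :=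
  \matrix_(j, l) 'D_(delta_mx 0 l) (fun Y => f Y I 0 j) X.

(* The derivative of f_iota with respect to the input parameter.              *)
Definition input_deriv (f : vector_field) (X : 'rV[R]_n) (I : R) : R :=
  derive1 (fun I' => f X I' 0 (inp G)) I.

Definition admissible (f : vector_field) : Prop :=
  [/\ forall j, smooth (fun z : 'rV[R]_n * R => f z.1 z.2 0 j),
      forall j, j != inp G -> forall X I I', f X I 0 j = f X I' 0 j,
      forall j (X Y : 'rV[R]_n) I, X 0 j = Y 0 j ->
        (forall l, arrow G l j -> X 0 l = Y 0 l) -> f X I 0 j = f Y I 0 j &
      forall j l, j != l ->
        (forall X I, jac f X I j l = 0) <-> ~~ arrow G l j].

Definition hyperbolic (J : 'M[R]_n) : Prop :=
  forall z : complex.complex R,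
    eigenvalue (map_mx (complex.real_complex R) J) z -> complex.Re z != 0.

Definition hyperbolic_equilibrium (f : vector_field) X0 I0 : Prop :=
  f X0 I0 = 0 /\ hyperbolic (jac f X0 I0).

(* X is the family of equilibria through X0: if X0 is hyperbolic, the         *)
(* implicit function theorem provides such an X, and its germ at I0 is unique.*)
Definition equilibrium_family (f : vector_field) (X0 : 'rV[R]_n) (I0 : R)
    (X : R -> 'rV[R]_n) : Prop :=
  [/\ X I0 = X0, {for I0, continuous X} & \forall I \near I0, f (X I) I = 0].

Definition homeostatic (X : R -> 'rV[R]_n) (I0 : R) (k : 'I_n) : Prop :=
  is_derive I0 1 (fun I => X I 0 k) 0.

(* A polynomial in the n^2 entries of J and in the derivative c of f_iota     *)
(* with respect to the input.                                                 *)
Definition eval_at (p : mpoly.mpoly (n * n + 1) R) (J : 'M[R]_n) (c : R) : R :=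
  mpoly.meval (row_mx (mxvec J) (const_mx c : 'rV[R]_1) 0) p.

(* The values of the Jacobian allowed by the network.                         *)
Definition supported (J : 'M[R]_n) : Prop :=
  forall j l, ~~ coupled G j l -> J j l = 0.

(* K => k.  The exceptional polynomial p depends only on K and k, and does    *)
(* not vanish identically on the set where the determinant of the block of K  *)
(* is zero.                                                                   *)
Definition induces (K : subnetwork n) (k : 'I_n) : Prop :=
  exists s t lev eta,
    [/\ homeostasis_blocks G s t lev,
        homeostasis_subnetwork G s t lev eta = K &
    exists p : mpoly.mpoly (n * n + 1) R,
      (exists J c, [/\ supported J,
         \det (homeostasis_block s t lev eta J) = 0 & eval_at p J c <> 0]) /\
      (forall f X0 I0 X,
         admissible f -> hyperbolic_equilibrium f X0 I0 ->
         equilibrium_family f X0 I0 X ->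
         \det (homeostasis_block s t lev eta (jac f X0 I0)) = 0 ->
         eval_at p (jac f X0 I0) (input_deriv f X0 I0) <> 0 ->
         homeostatic X I0 k)].

Definition induces_all (K : subnetwork n) (N : 'I_n -> Prop) : Prop :=
  forall k, N k -> induces K k.

End Dynamics.

(* Main.v *)
Require Import Defs.
From mathcomp Require Import all_boot all_order all_algebra.
From mathcomp Require Import all_classical all_reals all_analysis.
From HB Require Import structures.
From mathcomp Require Import perm ring lra.
From mathcomp Require mpoly.
From mathcomp Require Import -(notations) complex.

(** Let [J] be the Jacobian at the equilibrium and [c] the derivative of the
    function of the input node with respect to the input.  Differentiating the
    equation of the equilibria gives [J x' = - c e_iota], so that, by Cramer's
    rule, the node [k] is homeostatic exactly when [c * \det N_k = 0], where
    [N_k = setrow iota k J] is [J] with the row of the input replaced by the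
    basis row [e_k].  The block of an appendage subnetwork [A] is [J]
    restricted to the rows and columns in [A], up to permutations
    ([subnetwork_is_block_of]); its determinant is called [D] below and is
    the determinant of [rowsel A J].

    The two claims reduce to a separation property.  The node [Vmax A] of the
    chain is at or before [rho_j] if and only if every walk from [A] to the
    output meets [rho_j] ([Vmax_le_separates]).  If this holds, then [A]
    induces [rho_j] and every node from which the output is reached by a walk
    avoiding [rho_j] ([separates_induces]); these include the nodes of
    [L_(j+1)].  If it fails, then [A] does not induce [rho_j]
    ([not_separates_not_induces]), hence not [L_(j+1)] either, since [rho_j]
    belongs to [L_(j+1)].

    Separation implies induction because of cycles.  A nonzero term of
    [\det N_k] is a permutation, that is a path from the input to [k] together
    with disjoint cycles.  Under the separation hypothesis the path avoids [A],
    and a cycle through [A] stays in [A]: if it left [A] while consisting of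
    appendage nodes, these would belong to [A], and a cycle with a simple node
    contradicts the definition of super-appendage nodes, as the part of the
    path that ends at [rho_j] extends to an io-simple path missing the cycle
    ([supported_perm_preserves]).  So the entries of [N_k] between [A] and its
    complement may be erased without changing the determinant, and
    [\det N_k = 0] as soon as [D = 0] ([det_setrow_eq0]).  The same property
    of cycles for [k = out] shows that [A] is a strongly connected component
    of the graph that triangularizes the homeostasis matrix
    ([homeostasis_blocks_exist]).

    Conversely, if [A] is not separated from the output by [r = rho_j], there
    is an excursion from [A] back to [A], outside [A] and off every simple
    path from the input to [r] ([excursion]).  It yields a matrix with
    [D = 0] and [\det N_r != 0] ([chain_witness]).  The exceptional polynomial
    is only known not to vanish somewhere on the hypersurface [D = 0], so it
    remains to see that finitely many polynomial conditions, each satisfied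
    somewhere on the hypersurface, hold together at some real point of it.  As
    [D] is affine in each entry of [J], any two suitable points of the
    hypersurface are joined by a polynomial curve inside it
    ([locus_irreducible]), and a nonzero polynomial has finitely many roots.
    Hyperbolicity is obtained by multiplying the rows by generic constants one
    after the other ([scaling_hyperbolic], in the spirit of the theorem of
    Fisher and Fuller), an operation that preserves [D = 0].  The linear
    system with the resulting Jacobian is admissible and shows that [A] does
    not induce [r] ([linear_system_not_homeostatic]). *)

Set Implicit Arguments.
Unset Strict Implicit.
Unset Printing Implicit Defensive.

Import Order.TTheory GRing.Theory Num.Theory.
Import numFieldNormedType.Exports.

Local Notation restrict := Defs.restrict.

(** * Sequences, relations and permutations *)

Lemma split_first (T : eqType) (P : pred T) s : has P s ->
  exists s1 y s2, [/\ s = s1 ++ y :: s2, P y & all (predC P) s1].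
Proof.
elim: s => //= x s IH; have [Px _|nPx] := boolP (P x).
  by exists [::], x, s.
move=> /IH[s1 [y [s2 [-> Py a1]]]]; exists (x :: s1), y, s2; split=> //=.
by rewrite nPx.
Qed.

Lemma split_last (T : eqType) (P : pred T) t : has P t ->
  exists s1 y s2, [/\ t = s1 ++ y :: s2, P y & all (predC P) s2].
Proof.
rewrite -has_rev => /split_first[s1 [y [s2 [E Py a1]]]].
exists (rev s2), y, (rev s1); split=> //; last by rewrite all_rev.
by rewrite -[t]revK E rev_cat rev_cons cat_rcons.
Qed.

(** The edge by which a walk leaves [P] for the first time, with the two pieces
    of the walk around it. *)
Lemma connect_exit (T : finType) (e : rel T) (P : pred T) x y :
  connect e x y -> P x -> ~~ P y ->
  exists u v, [/\ P u, ~~ P v, e u v, connect e x u & connect e v y].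
Proof.
move=> /connectP[p pp ->]; elim: p x pp => [|z p IH] x /=.
  by move=> _ ->.
move=> /andP[xz pz] Px nP; have [Pz|nPz] := boolP (P z).
  have [u [v [Pu nPv uv zu vy]]] := IH z pz Pz nP.
  by exists u, v; split=> //; apply: connect_trans (connect1 xz) zu.
by exists x, z; split=> //; rewrite ?connect0 //; apply/connectP; exists p.
Qed.

Section LastFilter.
Variables (T : Type) (P : pred T) (f : T -> nat).

(** Turns a bound on the last selected item, which is how [Vmax] is defined,
    into a bound on all of them. *)
Lemma last_filter_le d s m : sorted leq (map f s) -> (f d <= m)%N ->
  (f (last d [seq x <- s | P x]) <= m)%N = all (fun V => P V ==> (f V <= m)%N) s.
Proof.
have tr : transitive (relpre f leq) by move=> a b c; apply: leq_trans.
rewrite sorted_map => /(path.sorted_filter tr P) st dm.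
rewrite -[RHS]/(all [pred V | P V ==> [pred W | (f W <= m)%N] V] s) -all_filter.
move: st; rewrite (sorted_pairwise tr).
case/lastP: [seq x <- s | P x] => [|t x] /=; first by rewrite dm.
rewrite pairwise_rcons last_rcons all_rcons /= => /andP[xt _].
apply/idP/andP => [xm|[]//]; split => //.
elim: t xt => //= a t IH; case/andP=> ax xt.
by rewrite (leq_trans ax xm) IH.
Qed.

End LastFilter.

Lemma sorting_perm m (f : 'I_m -> nat) :
  exists p : 'S_m, forall i j : 'I_m, (i <= j)%N -> (f (p i) <= f (p j))%N.
Proof.
pose t := sort (relpre f leq) (enum 'I_m).
have st : size t = m by rewrite size_sort size_enum_ord.
have ut : uniq t by rewrite sort_uniq enum_uniq.
pose g (i : 'I_m) := nth i t i.
have gE x (i : 'I_m) : g i = nth x t i.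
  by apply: set_nth_default; rewrite st ltn_ord.
have gi : injective g.
  move=> i j; rewrite (gE i i) (gE i j) => /eqP.
  by rewrite nth_uniq ?st ?ltn_ord // => /eqP/val_inj.
exists (perm gi) => i j ij; rewrite !permE (gE i i) (gE i j).
have tr : transitive (relpre f leq) by move=> a b c; apply: leq_trans.
have so : sorted (relpre f leq) t.
  by apply: sort_sorted => a b; apply: leq_total.
by apply: (sorted_leq_nth tr _ i so) => //; rewrite ?inE ?st ?ltn_ord // => a /=.
Qed.

Lemma prev_head (T : eqType) (x : T) p : uniq (x :: p) -> prev (x :: p) x = last x p.
Proof.
by move=> /andP[xp _]; rewrite prev_nth mem_head memNindex // -last_nth.
Qed.

Lemma next_last (T : eqType) (x : T) p : uniq (x :: p) -> next (x :: p) (last x p) = x.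
Proof. by move=> u; rewrite next_nth mem_last index_last // nth_default. Qed.

(** A finite set that an injection maps into itself is mapped onto itself. *)
Lemma perm_preserves_complement n (A : {set 'I_n}) (s : {perm 'I_n}) :
  (forall a, a \in A -> s a \in A) -> forall i, (s i \in A) = (i \in A).
Proof.
move=> sA i; apply/idP/idP => [siA|/sA//].
have sAE : (s @: A = A)%SET.
  apply/eqP; rewrite eqEcard card_imset ?leqnn ?andbT; last exact: perm_inj.
  by apply/fintype.subsetP => _ /imsetP[a aA ->]; apply: sA.
by move: siA; rewrite -{1}sAE => /imsetP[a aA /perm_inj->].
Qed.

(** * Paths and super-simple nodes *)

Section Paths.
Variables (n : nat) (G : network n).
Implicit Types (x y v r : 'I_n) (s p : seq 'I_n) (N A : {set 'I_n}).

Lemma simple_pathP x y s :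
  simple_path G x y s <->
  exists p, [/\ s = x :: p, path (arrow G) x p, last x p = y & uniq (x :: p)].
Proof.
case: s => [|a p] /=; first by split=> // -[p []].
split=> [/and4P[/eqP-> pp /eqP lp up]|[q [[-> ->] -> -> ->]]].
  by exists p.
by rewrite !eqxx.
Qed.

Lemma restrictE N x y :
  restrict G N x y = [&& x \in N, y \in N & arrow G x y].
Proof. by []. Qed.

Lemma restrict_path N x p :
  x \in N -> path (restrict G N) x p = path (arrow G) x p && all (mem N) p.
Proof.
elim: p x => //= y p IH x xN; rewrite restrictE xN /=.
have [yN|yN] /= := boolP (y \in N); last by rewrite andbF.
by rewrite IH // andbA.
Qed.

Lemma connect_restrictP N x y : x \in N ->
  reflect (exists p, [/\ path (arrow G) x p, last x p = y, uniq (x :: p) &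
                         {subset p <= N}])
          (connect (restrict G N) x y).
Proof.
move=> xN; apply: (iffP connectP) => [[p pp ->]|[p [pp <- up /allP sp]]].
  case: (shortenP pp) => q; rewrite restrict_path // => /andP[pq aq] uq _.
  by exists q; split=> //; apply/allP.
by exists p => //; rewrite restrict_path // pp.
Qed.

Lemma connect_restrict_path N x p : x \in N -> path (arrow G) x p ->
  {subset p <= N} -> connect (restrict G N) x (last x p).
Proof.
move=> xN pp /allP sp; apply/connectP; exists p => //.
by rewrite restrict_path // pp.
Qed.

Lemma connect_restrict_in N x y :
  connect (restrict G N) x y -> x \in N -> y \in N.
Proof.
move=> cxy xN; case/(connect_restrictP y xN): cxy => p [_ <- _ sp].
by case: p sp => //= a p sp; apply: sp; rewrite mem_last.
Qed.

Lemma connect_restrict_sub N N' x y : {subset N <= N'} ->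
  connect (restrict G N) x y -> connect (restrict G N') x y.
Proof.
move=> NN'; apply: connect_sub => a b /and3P[aN bN ab].
by apply: connect1; rewrite restrictE !NN'.
Qed.

(** There is a walk from [x] to [y] that never meets [r].  The condition on [x]
    is separate because the empty walk from [r] to [r] is a walk in any
    subnetwork. *)
Definition avoids r x y := (x != r) && connect (restrict G [set~ r]) x y.

Lemma avoids_refl r x : avoids r x x = (x != r).
Proof. by rewrite /avoids connect0 andbT. Qed.

Lemma avoids_trans r : transitive (avoids r).
Proof.
by move=> y x z /andP[xr xy] /andP[_ yz]; rewrite /avoids xr (connect_trans xy).
Qed.

Lemma avoids_path r x p : path (arrow G) x p -> r \notin x :: p ->
  avoids r x (last x p).
Proof.
rewrite inE negb_or eq_sym => pp /andP[xr rp]; rewrite /avoids xr /=.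
apply: connect_restrict_path => // [|z zp]; rewrite !inE //.
by apply: contraNneq rp => <-.
Qed.

Lemma avoids_restrict r N x y : r \notin N -> x \in N ->
  connect (restrict G N) x y -> avoids r x y.
Proof.
move=> rN xN cxy; rewrite /avoids; apply/andP; split.
  by apply: contraNneq rN => <-.
apply: connect_restrict_sub cxy => z zN; rewrite !inE.
by apply: contraNneq rN => <-.
Qed.

Lemma simple_path_of_walk x p : path (arrow G) x p ->
  exists2 s, simple_path G x (last x p) s & {subset s <= x :: p}.
Proof.
move=> pp; case: (shortenP pp) => q pq uq sq.
exists (x :: q); first by apply/simple_pathP; exists q.
by move=> z; rewrite !inE => /orP[->//|/sq->]; rewrite orbT.
Qed.

Lemma avoids_simple_path r x y : avoids r x y ->
  exists2 s, simple_path G x y s & r \notin s.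
Proof.
case/andP=> xr; have xN : x \in [set~ r]%SET by rewrite !inE.
case/(connect_restrictP y xN) => p [pp lp up sp].
exists (x :: p); first by apply/simple_pathP; exists p.
rewrite inE negb_or eq_sym xr /=; apply/negP => /sp.
by rewrite !inE eqxx.
Qed.

(** A walk can be shortened to a simple path, so a super-simple node lies on
    every walk from the input to the output, not only on the simple ones. *)
Lemma super_simple_cuts r : super_simple G r -> ~~ avoids r (inp G) (out G).
Proof. by move=> ssr; apply/negP => /avoids_simple_path[s /ssr ->]. Qed.

Lemma avoids_before r x y s u : simple_path G x y s -> u \in s -> r \in s ->
  (index u s < index r s)%N -> avoids r x u.
Proof.
case/simple_pathP=> p [-> pp lp up] us; move: pp lp up; move: us.
rewrite -[path _ _ _]/(sorted _ (x :: p)).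
move E: (x :: p) => t ut; case/splitPr: ut E => p1 p2 E st _ ut _ lt.
have up1 : u \notin p1.
  by move: ut; rewrite cat_uniq /= negb_or => /and3P[_ /andP[]].
have rp1 : r \notin rcons p1 u.
  rewrite mem_rcons inE negb_or; apply/andP; split.
    by apply/eqP => ru; rewrite ru ltnn in lt.
  apply/negP => rp1; move: lt; rewrite !index_cat (negPf up1) rp1 /= eqxx addn0.
  by rewrite ltnNge ltnW // index_mem.
move: st E; rewrite -cat_rcons => /cat_sorted2[s1 _].
case: p1 s1 rp1 {up1 ut lt} => [|a p1] /= s1 rp1 [-> _].
  by rewrite avoids_refl eq_sym; move: rp1; rewrite inE.
by rewrite -[u](last_rcons a p1); apply: avoids_path.
Qed.

Lemma avoids_after r x y s u : simple_path G x y s -> u \in s -> r \in s ->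
  (index r s < index u s)%N -> avoids r u y.
Proof.
case/simple_pathP=> p [-> pp lp up] us; move: pp lp up; move: us.
rewrite -[path _ _ _]/(sorted _ (x :: p)).
move E: (x :: p) => t ut; case/splitPr: ut E => p1 p2 E st lt ut rt ltu.
have up1 : u \notin p1.
  by move: ut; rewrite cat_uniq /= negb_or => /and3P[_ /andP[]].
move: ltu; rewrite !index_cat (negPf up1) /= eqxx addn0.
case: ifP => rp1; last by rewrite ltnNge leq_addr.
move=> _.
have ru : r \notin u :: p2.
  by move: ut; rewrite cat_uniq => /and3P[_ /hasPn H _]; apply/negP => /H; rewrite /= rp1.
have -> : y = last u p2.
  by rewrite -lt -[last x p]/(last x (x :: p)) E last_cat.
by move: st => /cat_sorted2[_ st]; apply: avoids_path.
Qed.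

Lemma avoids_before_last r x s u : simple_path G x r s -> u \in s -> u != r ->
  avoids r x u.
Proof.
move=> ps us ur; have [p [sE _ lp up]] : exists p,
  [/\ s = x :: p, path (arrow G) x p, last x p = r & uniq (x :: p)].
  exact/simple_pathP.
have rs : r \in s by rewrite sE -lp mem_last.
apply: (avoids_before ps) => //.
have ir : index r s = size p by rewrite sE -lp index_last.
have : (index u s <= size p)%N by rewrite -ltnS -[(size p).+1]/(size (x :: p)) -sE index_mem.
rewrite ir leq_eqVlt => /orP[/eqP iu|//].
by case/eqP: ur; rewrite -(nth_index u us) iu -ir nth_index.
Qed.

(** Continue [s] by a simple path from [r] to the output.  The two meet only in
    [r], since a common node would give a walk from the input to the output
    around [r]. *)
Lemma extend_to_io_path r s : core G -> super_simple G r ->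
  simple_path G (inp G) r s ->
  exists S, [/\ io_simple_path G S, {subset s <= S} &
                forall x, x \in S -> x \in s \/ avoids r x (out G)].
Proof.
move=> cG ssr sp; have [_ /connectP[q0 pq0 lq0]] := cG r.
case: (shortenP pq0) lq0 => q pq uq _ lq {q0 pq0}.
have avq x : x \in q -> avoids r x (out G).
  move=> xq; have rs : simple_path G r (out G) (r :: q).
    by apply/simple_pathP; exists q.
  apply: (avoids_after rs); rewrite ?inE ?eqxx ?xq ?orbT //=.
  have -> : (r == x) = false by apply/negbTE; case/andP: uq => /memPnC /(_ _ xq).
  by rewrite eqxx.
case/simple_pathP: (sp) => p [sE pp lp up].
exists (s ++ q); split.
- apply/simple_pathP; exists (p ++ q); split; first by rewrite sE.
  + by rewrite cat_path pp lp.
  + by rewrite last_cat lp.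
  have /andP[rq uq'] : (r \notin q) && uniq q by [].
  rewrite -cat_cons cat_uniq up -sE uq' andbT /=.
  apply/hasPn => x xq; apply/negP => xs.
  have xr : x != r by apply: contraNneq rq => <-.
  have : avoids r (inp G) x by apply: avoids_before_last sp xs xr.
  by move/avoids_trans => /(_ _ (avq _ xq)); rewrite (negPf (super_simple_cuts ssr)).
- by move=> x xs; rewrite mem_cat xs.
by move=> x; rewrite mem_cat => /orP[->|/avq]; [left|right].
Qed.

Lemma inp_super_simple : super_simple G (inp G).
Proof. by move=> s /simple_pathP[p [-> _ _ _]]; rewrite mem_head. Qed.

Lemma out_super_simple : super_simple G (out G).
Proof. by move=> s /simple_pathP[p [-> _ <- _]]; rewrite mem_last. Qed.

Lemma io_path_exists : core G -> exists s, io_simple_path G s.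
Proof.
move=> cG; have [_ /connectP[p pp lp]] := cG (inp G).
by have [s] := simple_path_of_walk pp; rewrite -lp => ? _; exists s.
Qed.

Lemma super_simple_simple r : core G -> super_simple G r -> simple G r.
Proof. by move=> cG ssr; have [s ps] := io_path_exists cG; exists s => //; apply: ssr. Qed.

(** For a super-simple [r], the order [prec] is a matter of reachability: the
    nodes after [r] reach the output without meeting [r], and the nodes before
    [r] are reached from the input without meeting [r].  By
    [super_simple_cuts] no node has both properties. *)
Lemma prec_avoids_out r y : super_simple G r -> prec G r y -> avoids r y (out G).
Proof.
move=> ssr [rney [s [m [ps ssm [rs ms ys] /andP[rm my]]]]].
apply: (avoids_after ps) => //; rewrite ltn_neqAle (leq_trans rm my) andbT.
apply/eqP => irm; apply: rney; rewrite -(nth_index r rs) irm.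
by rewrite nth_index.
Qed.

Lemma prec_avoids_inp r y : super_simple G r -> prec G y r -> avoids r (inp G) y.
Proof.
move=> ssr [rney [s [m [ps ssm [rs ms ys] /andP[rm my]]]]].
apply: (avoids_before ps) => //; rewrite ltn_neqAle (leq_trans rm my) andbT.
apply/eqP => irm; apply: rney; rewrite -(nth_index r rs) irm.
by rewrite nth_index.
Qed.

Lemma avoids_inp_out r x : super_simple G r ->
  avoids r (inp G) x -> avoids r x (out G) -> False.
Proof.
by move=> /super_simple_cuts/negP H a b; apply: H; apply: avoids_trans a b.
Qed.

Lemma index_prec x y s : io_simple_path G s -> x \in s -> y \in s ->
  x <> y -> super_simple G x \/ super_simple G y ->
  (index x s <= index y s)%N -> prec G x y.
Proof.
move=> ps xs ys xy ss le; split=> //.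
by case: ss => ss; [exists s, x|exists s, y]; split=> //; rewrite leqnn ?andbT.
Qed.

Lemma simple_trichotomy r y s : super_simple G r -> io_simple_path G s -> y \in s ->
  [\/ y = r, prec G r y | prec G y r].
Proof.
move=> ssr ps ys; have rs := ssr _ ps.
have [->|/eqP yr] := eqVneq y r; first by constructor 1.
have [le|/ltnW le] := leqP (index r s) (index y s).
  by constructor 2; apply: (@index_prec _ _ s) => //; [apply/nesym|left].
by constructor 3; apply: (@index_prec _ _ s) => //; right.
Qed.

End Paths.

(** * The chain of super-simple nodes *)

Section Chain.
Variables (n : nat) (G : network n).
Hypothesis cG : core G.
Implicit Types (x y v r : 'I_n) (s p : seq 'I_n) (N A : {set 'I_n}).
Local Notation L := (super_simple_nodes G).
Local Notation q2 := (nb_super_simple G).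

Lemma mem_super_simple_nodes v : (v \in L) = `[< super_simple G v >].
Proof. by rewrite mem_sort mem_filter mem_enum andbT. Qed.

Lemma uniq_super_simple_nodes : uniq L.
Proof. by rewrite sort_uniq filter_uniq // enum_uniq. Qed.

Lemma rho_super_simple j : (j < q2)%N -> super_simple G (rho G j).
Proof. by move=> jq; apply/asboolP; rewrite -mem_super_simple_nodes mem_nth. Qed.

Lemma super_simple_rho v : super_simple G v -> exists2 j, (j < q2)%N & v = rho G j.
Proof.
move=> /asboolP; rewrite -mem_super_simple_nodes => vL.
by exists (index v L); [rewrite index_mem|rewrite /rho nth_index].
Qed.

(** The position relative to a super-simple node does not depend on the
    io-simple path on which it is read off. *)
Lemma prec_index_lt r y s : super_simple G r -> io_simple_path G s -> y \in s ->
  prec G y r -> (index y s < index r s)%N.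
Proof.
move=> ssr ps ys pry; rewrite ltnNge; apply/negP => le.
have rs := ssr _ ps; have [ney _] := pry.
have /prec_avoids_out := index_prec ps rs ys (nesym ney) (or_introl ssr) le.
move=> /(_ ssr); apply: avoids_inp_out => //; exact: prec_avoids_inp.
Qed.

Lemma prec_index_gt r y s : super_simple G r -> io_simple_path G s -> y \in s ->
  prec G r y -> (index r s < index y s)%N.
Proof.
move=> ssr ps ys pry; rewrite ltnNge; apply/negP => le.
have rs := ssr _ ps; have [ney _] := pry.
have /prec_avoids_inp := index_prec ps ys rs (nesym ney) (or_intror ssr) le.
by move=> /(_ ssr) H; apply: (avoids_inp_out ssr H); apply: prec_avoids_out.
Qed.

(** Among super-simple nodes [prec] agrees with the order of appearance on one
    fixed io-simple path, hence it is total and transitive there and the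
    sorting that defines [rho] is meaningful. *)
Lemma rho_prec i j : (i < j < q2)%N -> prec G (rho G i) (rho G j).
Proof.
case/andP=> ij jq; have iq := ltn_trans ij jq.
have [s ps] := io_path_exists cG.
pose le := fun x y : 'I_n => `[< x = y \/ prec G x y >].
pose P := [pred v | `[< super_simple G v >]].
have leE : {in P &, forall x y, le x y = (index x s <= index y s)%N}.
  move=> x y /asboolP ssx /asboolP ssy; apply/asboolP/idP => [[->//|pxy]|ixy].
    by apply: ltnW; apply: prec_index_lt => //; apply: ssx.
  have [->|/eqP xy] := eqVneq x y; [by left|right].
  by apply: (@index_prec _ _ _ _ s) => //; [apply: ssx|apply: ssy|left].
have aP : all P L by apply/allP => v; rewrite mem_super_simple_nodes.
have tot : {in P &, total le} by move=> x y xP yP; rewrite !leE // leq_total.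
have tr : {in P & &, transitive le}.
  by move=> x y z xP yP zP; rewrite !leE //; apply: leq_trans.
have so : sorted le L.
  apply: (sort_sorted_in tot); apply/allP => v; rewrite mem_filter => /andP[sv _].
  exact: sv.
have /asboolP := sorted_ltn_nth_in tr (inp G) aP so _ _ iq jq ij.
case=> // /eqP; rewrite nth_uniq ?uniq_super_simple_nodes // => /eqP ijE.
by rewrite ijE ltnn in ij.
Qed.

Lemma nb_super_simple_gt0 : (0 < q2)%N.
Proof. by have [j jq _] := super_simple_rho (@inp_super_simple _ G); case: (q2) jq. Qed.

Lemma avoidsNr r x : avoids G r x r = false.
Proof.
apply/negP => /andP[xr]; move=> /connect_restrict_in.
by rewrite !inE xr eqxx => /(_ isT).
Qed.

(** A simple node that is not super-simple lies between the last super-simple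
    node before it and the next one. *)
Lemma simple_chain_node y : simple G y -> exists i,
  ((i < q2)%N /\ y = rho G i) \/ ((0 < i < q2)%N /\ simple_subnetwork G i y).
Proof.
move=> sy; have [s ps ys] := sy.
have [ssy|nssy] := pselect (super_simple G y).
  by have [j jq ->] := super_simple_rho ssy; exists j; left.
pose P i := (i < q2)%N && `[< prec G (rho G i) y >].
have exP : exists i, P i.
  have [j jq jE] := super_simple_rho (@inp_super_simple _ G).
  exists j; rewrite /P jq /= -jE; apply/asboolP.
  case: (simple_trichotomy (@inp_super_simple _ G) ps ys) => [yE||/prec_avoids_inp] //.
    by case: nssy; rewrite yE; apply: inp_super_simple.
  by move=> /(_ (@inp_super_simple _ G)) /andP[]; rewrite eqxx.
have bP i : P i -> (i <= q2)%N by case/andP=> /ltnW.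
case: (ex_maxnP exP bP) => i /andP[iq /asboolP iy] imax.
have [z zq zE] := super_simple_rho (@out_super_simple _ G).
have zy : prec G y (rho G z).
  rewrite -zE; case: (simple_trichotomy (@out_super_simple _ G) ps ys) => [yE|/prec_avoids_out|] //.
    by case: nssy; rewrite yE; apply: out_super_simple.
  by move=> /(_ (@out_super_simple _ G)); rewrite avoidsNr.
have iz : (i < z)%N.
  have := ltn_trans (prec_index_gt (rho_super_simple iq) ps ys iy)
                    (prec_index_lt (rho_super_simple zq) ps ys zy).
  case: (ltngtP i z) => [//|zi|->]; last by rewrite ltnn.
  have := prec_avoids_out (rho_super_simple zq) (@rho_prec z i _).
  by rewrite zi iq => /(_ isT); rewrite -zE avoidsNr.
have iq1 := leq_ltn_trans iz zq.
exists i.+1; right; split=> //; split=> //.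
case: (simple_trichotomy (rho_super_simple iq1) ps ys) => [yE|iy1|//].
  by case: nssy; rewrite yE; apply: rho_super_simple.
have : P i.+1 by rewrite /P iq1; apply/asboolP.
by move/imax; rewrite ltnn.
Qed.

Lemma all_structural_pattern (a : pred chain_node) :
  all a (structural_pattern G) <->
  (forall i, (i < q2)%N -> a (SuperSimple i)) /\
  (forall i, (0 < i < q2)%N -> a (Backbone i)).
Proof.
have q0 := nb_super_simple_gt0.
have E m : (0 < m < q2)%N = (m \in iota 1 q2.-1).
  by rewrite mem_iota add1n prednK.
have flat t : all a (flatten [seq [:: Backbone j; SuperSimple j] | j <- t]) =
              all (fun j => a (Backbone j) && a (SuperSimple j)) t.
  by elim: t => //= j t ->; rewrite andbA.
rewrite /structural_pattern /= flat; split.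
  move=> /andP[a0 /allP H]; split=> i.
    case: i => // i iq; have := H i.+1; rewrite -E iq => /(_ isT) /=.
    by case/andP.
  by rewrite E => /H /= /andP[].
move=> [H1 H2]; rewrite H1 //=; apply/allP => i; rewrite -E => iq /=.
by rewrite H2 // H1 //; case/andP: iq.
Qed.

Lemma structural_pattern_sorted :
  sorted leq (map chain_position (structural_pattern G)).
Proof.
rewrite /structural_pattern /= -[X in path _ X]/(0.*2).
elim: (q2.-1) 0%N => //= k IH m.
by rewrite IH andbT doubleS /= ?leqnSn ?ltnSn.
Qed.

Definition separates_from_out r A := forall a, a \in A -> ~~ avoids G r a (out G).

(** On a walk from [A] to the output around [rho_j], the first simple node [y]
    is the end of an appendage path from [A].  If [Vmax A] is at or before
    [rho_j], so is [y], and then [y] is reached from the input around [rho_j]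
    as well, which contradicts that [rho_j] is super-simple.  Conversely, an
    appendage path from [A] to a simple node after [rho_j] continues to the
    output without meeting [rho_j]. *)
Lemma Vmax_le_separates A j : {in A, forall a, appendage G a} -> (j < q2)%N ->
  (chain_position (Vmax G A) <= j.*2)%N <-> separates_from_out (rho G j) A.
Proof.
move=> apA jq; have ssj := rho_super_simple jq.
rewrite /Vmax last_filter_le //; last exact: structural_pattern_sorted.
rewrite all_structural_pattern; split=> [[H1 H2] a aA|sep].
  apply/negP => /avoids_simple_path[s ps rs].
  case/simple_pathP: (ps) => p [sE pp lp up].
  have os : has (fun v => `[< simple G v >]) s.
    apply/hasP; exists (out G); first by rewrite sE -lp mem_last.
    by apply/asboolP/super_simple_simple => //; apply: out_super_simple.
  have [s1 [y [s2 [E /asboolP sy /allP a1]]]] := split_first os.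
  have ap1 v : v \in s1 -> appendage G v by move=> /a1 /= /asboolP.
  have as1 : a \in s1.
    case: s1 {a1 ap1} E => [|b s1]; rewrite sE => -[aE _].
      by case: (apA a aA); rewrite aE.
    by rewrite aE mem_head.
  have yr : y != rho G j.
    by apply: contraNneq rs => <-; rewrite E mem_cat mem_head orbT.
  have pth V : represented G V y -> appendage_path_to G A V.
    move=> Vy; exists a, y, (rcons s1 y); split=> //; split.
    - apply/simple_pathP; exists (rcons (behead s1) y).
      have s1E : s1 = a :: behead s1.
        by case: (s1) as1 E => // b t _; rewrite sE => -[->].
      move: E pp up; rewrite sE {1 2}s1E /= => -[->]; rewrite -cat_rcons cat_path.
      move=> /andP[-> _] /andP[]; rewrite mem_cat negb_or => /andP[-> _].
      by rewrite cat_uniq => /andP[-> _]; rewrite last_rcons.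
    - by exists a; [rewrite mem_rcons inE as1 orbT|apply: apA].
    by move=> v; rewrite mem_rcons inE => /orP[/eqP->|/ap1].
  have y_out : avoids G (rho G j) y (out G).
    have y2 : rho G j \notin y :: s2.
      by apply: contra rs; rewrite E mem_cat => ->; rewrite orbT.
    have -> : out G = last y s2.
      by rewrite -lp -[last a p]/(last a (a :: p)) -sE E last_cat.
    apply: avoids_path y2.
    by move: pp; rewrite -[path _ a p]/(sorted (arrow G) (a :: p)) -sE E => /cat_sorted2[].
  have [t pt yt] := sy.
  have inp_y : (index y t < index (rho G j) t)%N.
    have [i [[iq yE]|[iq yi]]] := simple_chain_node sy.
      have := H1 i iq; rewrite (asboolT (pth (SuperSimple i) yE)) implyTb.
      rewrite /= leq_double leq_eqVlt => /orP[/eqP ij|ij].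
        by rewrite yE ij eqxx in yr.
      by apply: prec_index_lt => //; rewrite yE; apply: rho_prec; rewrite ij.
    have := H2 i iq; rewrite (asboolT (pth (Backbone i) (or_introl yi))).
    rewrite implyTb /= => ij.
    have {}ij : (i <= j)%N.
      case: i {iq yi} ij => //= i ij.
      by rewrite -ltn_double.
    case/andP: iq => i0 iq; have [_ _ py] := yi.
    apply: (leq_trans (prec_index_lt (rho_super_simple iq) pt yt py)).
    move: ij; rewrite leq_eqVlt => /orP[/eqP->//|ij]; apply: ltnW.
    apply: prec_index_lt => //; first exact: (rho_super_simple iq).
    by apply: rho_prec; rewrite ij.
  apply: (avoids_inp_out ssj) y_out.
  by apply: (avoids_before pt) => //; apply: ssj.
(* no appendage path from A ends after rho_j *)
have key x y s : x \in A -> appendage_path G x y s -> avoids G (rho G j) y (out G) -> False.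
  move=> xA [ps _ aps] yo.
  have rs : rho G j \notin s.
    have rsi := super_simple_simple cG ssj.
    have [rx ry] : rho G j <> x /\ rho G j <> y.
      split=> E; first by case: (apA _ xA); rewrite -E.
      by move: yo; rewrite -E /avoids eqxx.
    by apply/negP => /aps /(_ rx ry).
  have /negP := sep _ xA; apply; apply: avoids_trans yo.
  by case/simple_pathP: ps rs => p [-> pp <- _]; apply: avoids_path.
split=> i iq; apply/implyP => /asboolP[x [y [s [xA sy Vy aps]]]].
  rewrite /= leq_double leqNgt; apply/negP => ij.
  apply: (key _ _ _ xA aps); rewrite Vy; apply: prec_avoids_out => //.
  by apply: rho_prec; rewrite ij.
rewrite /= leqNgt; apply/negP => ij; apply: (key _ _ _ xA aps).
have [t pt yt] := sy.
case: Vy => [[_ py _]|[]]; last by [].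
case/andP: iq; case: i py ij => // i /= py ij _ iq.
have {}ij : (j <= i)%N by rewrite -leq_double.
have lt : (index (rho G j) t < index y t)%N.
  apply: leq_trans (prec_index_gt (rho_super_simple (ltnW iq)) pt yt py).
  rewrite ltnS; move: ij; rewrite leq_eqVlt => /orP[/eqP->//|ij]; apply: ltnW.
  apply: prec_index_lt => //; first exact: (rho_super_simple (ltnW iq)).
    by apply: ssj.
  by apply: rho_prec; rewrite ij ltnW.
by apply: (avoids_after pt) => //; apply: ssj.
Qed.

End Chain.

(** * Appendage subnetworks, cycles and excursions *)

Section Appendage.
Variables (n : nat) (G : network n).
Implicit Types (x y v r : 'I_n) (s p : seq 'I_n) (N A : {set 'I_n}).

Local Notation SA := [set w | `[< super_appendage G w >]]%SET.

Variable A : {set 'I_n}.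
Hypothesis appA : appendage_subnetwork G A.

Lemma appendage_subnetwork_super_appendage a : a \in A -> super_appendage G a.
Proof.
case: appA => v sv ->; rewrite inE => /andP[cva _].
have : a \in SA by apply: (connect_restrict_in cva); rewrite inE; apply/asboolP.
by rewrite inE => /asboolP.
Qed.

Lemma appendage_subnetwork_appendage a : a \in A -> appendage G a.
Proof. by case/appendage_subnetwork_super_appendage. Qed.

Lemma appendage_subnetwork_neq0 : exists a, a \in A.
Proof. by case: appA => v sv ->; exists v; rewrite inE connect0. Qed.

Lemma appendage_subnetwork_closed a b : a \in A ->
  connect (restrict G SA) a b -> connect (restrict G SA) b a -> b \in A.
Proof.
case: appA => v sv ->; rewrite !inE => /andP[va av] ab ba.
by rewrite (connect_trans va ab) (connect_trans ba av).
Qed.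

(** All nodes of a path that joins two nodes of a strongly connected component
    belong to this component. *)
Lemma appendage_subnetwork_connect a b : a \in A -> b \in A ->
  connect (restrict G A) a b.
Proof.
move=> aA bA.
have aS : a \in SA.
  by rewrite inE; apply/asboolP/appendage_subnetwork_super_appendage.
have [ab ba] : connect (restrict G SA) a b /\ connect (restrict G SA) b a.
  case: appA aA bA => v sv ->; rewrite !inE => /andP[va av] /andP[vb bv].
  by rewrite (connect_trans av vb) (connect_trans bv va).
case/(connect_restrictP G b aS): ab => p [pp lp up sp].
rewrite -lp; apply: connect_restrict_path => // z zp.
case/splitPr: zp pp lp sp {up} => p1 p2 pp lp sp.
move: pp lp; rewrite -cat_rcons cat_path last_cat last_rcons => /andP[pp1 pp2] lp.
have zS : z \in SA by apply: sp; rewrite mem_cat mem_head orbT.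
apply: (appendage_subnetwork_closed aA).
  rewrite -[z in X in is_true X](last_rcons a p1).
  apply: connect_restrict_path => // t tp; apply: sp.
  by rewrite -cat_rcons mem_cat tp.
apply: connect_trans ba; rewrite -lp; apply: connect_restrict_path => // t tp.
by apply: sp; rewrite mem_cat inE tp !orbT.
Qed.

Hypothesis cG : core G.

Lemma split_simple_path x y s1 r s2 : simple_path G x y (s1 ++ r :: s2) ->
  [/\ simple_path G x r (rcons s1 r), path (arrow G) r s2, last r s2 = y &
      uniq (r :: s2)].
Proof.
case/simple_pathP => p []; case: s1 => [|a s1] [-> <-].
  rewrite [last _ _]/= => pp lp ur; split=> //.
  by apply/simple_pathP; exists [::].
rewrite -cat_rcons cat_path last_cat last_rcons => /andP[p1 p2] lp.
rewrite -cat_cons cat_uniq => /and3P[u1 h u2].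
split=> //; last first.
  rewrite /= u2 andbT; apply/negP => rs; move/hasPn: h => /(_ _ rs).
  by rewrite /= inE mem_rcons mem_head orbT.
by apply/simple_pathP; exists (rcons s1 r); rewrite last_rcons.
Qed.

Section Perm.
Variables (s : {perm 'I_n}) (k : 'I_n).
Hypothesis sc : forall i, i != inp G -> coupled G i (s i).
Hypothesis sk : s (inp G) = k.

(** Each entry [f_{i, s i}] of a nonzero term is an arrow from [s i] to [i] (or
    a diagonal entry).  So the cycle of the input, read backwards from the
    input to its image [k], is a path of the network. *)
Lemma perm_orbit_path : exists2 t, simple_path G (inp G) k (inp G :: t) &
  inp G :: t =i orbit s (inp G).
Proof.
have si : injective s by apply: perm_inj.
have := cycle_orbit si (inp G); have := orbit_uniq s (inp G).
have : orbit s (inp G) = inp G :: behead (orbit s (inp G)).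
  by rewrite /orbit -orderSpred.
move tE: (behead _) => t ->.
rewrite [cycle _ _]/= [uniq _]/= => /andP[it ut] ct.
have cs : forall y, y \in t -> y != inp G /\ s y != y.
  move=> y yt; have yi : y != inp G by apply: contraNneq it => <-.
  split=> //; apply/eqP => sy.
  have : fconnect s (inp G) y.
    rewrite fconnect_orbit /orbit -orderSpred /= -/(traject _ _ _).
    have -> : traject s (s (inp G)) (order s (inp G)).-1 = t.
      by rewrite -tE /orbit -orderSpred.
    by rewrite inE yt orbT.
  rewrite (fconnect_sym si) => /iter_findex; rewrite (_ : iter _ _ _ = y).
    by move/eqP; rewrite (negPf yi).
  by elim: (findex _ _ _) => //= j ->.
exists (rev t); last by move=> y; rewrite !inE mem_rev.
apply/simple_pathP; exists (rev t); split=> //; last by rewrite /= mem_rev it rev_uniq.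
  have : path (fun z y => s y == z) (inp G) (rcons (rev t) (inp G)).
    rewrite -rev_cons -(belast_rcons (inp G) t (inp G)).
    by rewrite -{1}(last_rcons (inp G) t (inp G)) rev_path.
  rewrite rcons_path => /andP[+ _].
  have : {subset rev t <= t} by move=> y; rewrite mem_rev.
  elim: (rev t) (inp G) => //= y p IH x sub /andP[/eqP yx pp].
  have [yi sy] := cs _ (sub _ (mem_head _ _)).
  have := sc yi; rewrite /coupled eq_sym (negPf sy) /= yx => ->.
  by apply: IH pp => z zp; apply: sub; rewrite inE zp orbT.
rewrite -sk; case: (t) ct => [|h t'] /= /andP[/eqP-> _] //.
by rewrite rev_cons last_rcons.
Qed.

Lemma perm_orbit_connect (C : {set 'I_n}) x : (forall j, iter j s x \in C) ->
  (forall j, iter j s x != inp G) ->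
  forall j, connect (restrict G C) (iter j s x) x.
Proof.
move=> xC xi; elim=> [|j IH]; first exact: connect0.
apply: connect_trans IH => /=.
have := sc (xi j); rewrite /coupled => /orP[/eqP <-|a]; first exact: connect0.
by apply: connect1; rewrite restrictE xC (xC j.+1).
Qed.

(** Let [P] be the path from the input to [k] formed by the orbit of the input.
    It meets [r], and its part up to [r] extends to an io-simple path [S].  If
    [a] were on [P], it would be on [S] or would reach the output around [r],
    via [k].  So the orbit [C] of [a] is disjoint from [P], and also from [S],
    because the nodes of [S] outside [P] reach the output around [r].  Hence
    [C] lies in one transitive component of the complementary subnetwork of
    [S].  As [a] is super-appendage, all nodes of [C] are appendage, so [C] is
    disjoint from every io-simple path; hence its nodes are super-appendage as
    well, and [C] lies in [A]. *)
Lemma supported_perm_preserves r a : super_simple G r ->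
  separates_from_out G r A -> k = r \/ avoids G r k (out G) ->
  a \in A -> s a \in A.
Proof.
move=> ssr sep kr aA.
have si : injective s by apply: perm_inj.
have [t pt tE] := perm_orbit_path.
set P := inp G :: t in pt tE.
have nkout : k <> r -> avoids G r k (out G) by case: kr.
have rP : r \in P.
  apply/negPn/negP => rP; have kr' : k <> r.
    move=> kr'; case/negP: rP; rewrite -kr'.
    by case/simple_pathP: pt => p [-> _ <- _]; rewrite mem_last.
  apply: (avoids_inp_out ssr) (nkout kr').
  by case/simple_pathP: pt rP => p [-> pp <- _]; apply: avoids_path.
have [S [pS sPS SE]] : exists S, [/\ io_simple_path G S,
    forall x, x \in P -> (index x P <= index r P)%N -> x \in S &
    forall x, x \in S -> x \in P \/ avoids G r x (out G)].
  move: pt; case/splitPr: rP => p1 p2 pt.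
  have [pr _ _ ur2] := split_simple_path pt.
  have [S [pS sS SE]] := extend_to_io_path cG ssr pr.
  exists S; split=> // x.
    rewrite -cat_rcons mem_cat => /orP[/sS//|xp2].
    have xr : r == x = false by apply/negbTE; case/andP: ur2 => /memPnC /(_ _ xp2).
    rewrite cat_rcons !index_cat /= eqxx addn0 xr.
    case: (boolP (x \in p1)) => [xp1 _|_]; first by apply: sS; rewrite mem_rcons inE xp1 orbT.
    case: (boolP (r \in p1)) => [rp1|_]; last by rewrite addnS ltnNge leq_addr.
    move: pt => /simple_pathP[p [E _ _]]; rewrite -E cat_uniq => /and3P[_ /hasPn/(_ r)].
    by rewrite mem_head rp1 => /(_ isT).
  move/SE => [|]; last by right.
  by rewrite mem_rcons inE mem_cat inE => /orP[->|->]; rewrite ?orbT; left.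
have apS x : x \in S -> simple G x by move=> xS; exists S.
have aP : a \notin P.
  apply/negP => aP; have [le|lt] := leqP (index a P) (index r P).
    by case: (appendage_subnetwork_appendage aA); apply: apS; apply: sPS.
  have ak := avoids_after pt aP rP lt.
  have kr' : k <> r by move=> E; move: ak; rewrite E avoidsNr.
  by case/negP: (sep _ aA); apply: avoids_trans ak (nkout kr').
pose C := [set x | fconnect s a x]%SET.
have itC x j : x \in C -> iter j s x \in C.
  by rewrite !inE => ax; apply: connect_trans ax (fconnect_iter _ _ _).
have aC : a \in C by rewrite inE connect0.
have CP x : x \in C -> x \notin P.
  rewrite inE tE -fconnect_orbit => ax; apply: contra aP.
  rewrite tE -fconnect_orbit => ix; apply: connect_trans ix _.
  by rewrite (fconnect_sym si).
have Ci x : x \in C -> x != inp G.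
  by move=> /CP; apply: contraNneq => ->; rewrite mem_head.
have Cto x y : x \in C -> y \in C -> connect (restrict G C) y x.
  move=> xC yC; have : fconnect s x y.
    by move: xC yC; rewrite !inE (fconnect_sym si) => /connect_trans; apply.
  move=> /iter_findex <-; apply: perm_orbit_connect => j; first exact: itC.
  by apply/Ci/itC.
have CS x : x \in C -> x \notin S.
  move=> xC; apply/negP => /SE[|xo]; first exact/negP/CP.
  case/negP: (sep _ aA); apply: avoids_trans xo.
  apply: (avoids_restrict _ aC (Cto x a xC aC)).
  by apply/negP => /CP; rewrite rP.
have sup N x y : {subset C <= N} -> x \in C -> y \in transitive_component G N x ->
    y \in transitive_component G N a.
  move=> CN xC; rewrite !inE => /andP[xy yx].
  rewrite (connect_trans _ xy) ?(connect_trans yx) //;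
    by apply: connect_restrict_sub CN _; apply: Cto.
have CN N x : {subset C <= N} -> x \in C -> x \in transitive_component G N a.
  by move=> CN xC; apply: (sup _ x) => //; rewrite inE !connect0.
have [_ saA] := appendage_subnetwork_super_appendage aA.
have Cap x : x \in C -> appendage G x.
  move=> xC; apply: (saA S pS); first by rewrite inE CS.
  by apply: CN => // y yC; rewrite inE CS.
have Csa x : x \in C -> super_appendage G x.
  move=> xC; split=> [|S' pS' xS' w wx]; first exact: Cap.
  have CS' : {subset C <= complementary S'}.
    by move=> y yC; rewrite inE; apply/negP => yS'; apply: (Cap _ yC); exists S'.
  by apply: (saA S' pS'); [apply: CS'|apply: (sup _ x)].
have CSA : {subset C <= SA} by move=> x xC; rewrite inE; apply/asboolP/Csa.
have saC : s a \in C by apply: (itC a 1%N).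
by apply: (appendage_subnetwork_closed aA);
  apply: connect_restrict_sub CSA _; apply: Cto.
Qed.

End Perm.

(** Let [W] be the part after the last node in [A] of a walk from [A] to the
    output around [r], and [U] the part before the first node in [A] of a path
    from the input to [A].  If [U] and [W] were disjoint, joining them through
    [A] would give an io-simple path that meets [A].  So they share a node [w],
    and following [W] up to [w] and then [U] leads from [A] back to [A].  All
    nodes of this excursion reach the output around [r], so none of them is on
    a simple path from the input to [r]. *)
Lemma excursion r a : super_simple G r -> a \in A -> avoids G r a (out G) ->
  exists (q : 'I_n) (g : seq 'I_n) (b : 'I_n), [/\ q \in A, b \in A,
    [/\ path (arrow G) q g, uniq g, arrow G (last q g) b & last q g \in g] &
    forall x, x \in g -> x \notin A /\ avoids G r x (out G)].
Proof.
move=> ssr aA /avoids_simple_path[s ps rs].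
have apA := appendage_subnetwork_appendage.
have iA : inp G \notin A.
  by apply/negP => /apA; apply; apply: super_simple_simple => //; apply: inp_super_simple.
have rA : r \notin A.
  by apply/negP => /apA; apply; apply: super_simple_simple.
have [s1 [a2 [W [sE a2A /allP WA]]]] : exists s1 y s2,
    [/\ s = s1 ++ y :: s2, y \in A & all [predC A] s2].
  apply: split_last; apply/hasP; exists a => //.
  by case/simple_pathP: ps => p [-> _ _ _]; rewrite mem_head.
rewrite sE in ps rs; have [_ pW lW uW] := split_simple_path ps.
have {rs} rW : r \notin a2 :: W by apply: contra rs; rewrite mem_cat => ->; rewrite orbT.
have [_ [/connectP[u0 pu0 lu0]]] := (cG (out G), cG a).
case: (shortenP pu0) lu0 => u1 pu1 uu1 _ lu1 {u0 pu0} _.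
have pu : simple_path G (inp G) a (inp G :: u1) by apply/simple_pathP; exists u1.
have [U [a1 [U2 [uE a1A /allP UA]]]] : exists s1 y s2,
    [/\ inp G :: u1 = s1 ++ y :: s2, y \in A & all [predC A] s1].
  by apply: split_first; apply/hasP; exists a => //; rewrite lu1 mem_last.
rewrite uE in pu; have [pU _ _ _] := split_simple_path pu.
have a12 := appendage_subnetwork_connect a1A a2A.
have a2out : avoids G r a2 (out G) by rewrite -lW; apply: avoids_path.
have [hasW|hasN] := boolP (has (mem W) U); last first.
  case: (apA _ a1A).
  case/(connect_restrictP G a2 a1A): a12 => q [pq lq uq sq].
  exists (rcons U a1 ++ (q ++ W)); last by rewrite mem_cat mem_rcons mem_head.
  case/simple_pathP: pU => p [pE pp lp up].
  apply/simple_pathP; exists (p ++ (q ++ W)); split.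
  - by rewrite pE.
  - by rewrite !cat_path pp lp pq lq pW.
  - by rewrite !last_cat lp lq lW.
  rewrite -cat_cons -pE cat_rcons -cat_cons catA cat_uniq.
  have uqA : {subset a1 :: q <= A} by move=> x; rewrite inE => /orP[/eqP->|/sq].
  have -> : uniq W by case/andP: uW.
  rewrite cat_uniq uq.
  have -> : uniq U by move: up; rewrite -pE rcons_uniq => /andP[].
  have -> : ~~ has (mem U) (a1 :: q).
    by apply/hasPn => x /uqA xA; apply/negP => /UA /=; rewrite xA.
  rewrite !andbT /=; apply/hasPn => x xW; rewrite mem_cat negb_or; apply/andP; split.
    by apply: contra hasN => xU; apply/hasP; exists x.
  by apply/negP => /uqA xA; have := WA _ xW; rewrite /= xA.
have [w wU wW] := hasP hasW.
have avW x : x \in W -> avoids G r x (out G).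
  move=> xW; case/splitPr: xW pW lW rW => v1 v2.
  rewrite -cat_rcons cat_path last_cat last_rcons => /andP[_ pv] lv rv.
  rewrite -lv; apply: avoids_path => //; apply: contra rv => rx.
  by rewrite cat_rcons inE mem_cat rx !orbT.
have rU : forall x, x \in rcons U a1 -> (index w (rcons U a1) < index x (rcons U a1))%N -> x <> r.
  move=> x xU lt xr; rewrite xr in xU lt.
  apply: (avoids_inp_out ssr) (avW _ wW); apply: (avoids_before pU _ xU lt).
  by rewrite mem_rcons inE wU orbT.
have [u3 [u4 UE]] : exists u3 u4, U = u3 ++ w :: u4.
  by case/splitPr: wU => u3 u4; exists u3, u4.
have [v1 [v2 WE]] : exists v1 v2 : seq _, W = v1 ++ w :: v2.
  by case/splitPr: wW => v1 v2; exists v1, v2.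
have pU' : simple_path G (inp G) a1 (u3 ++ w :: rcons u4 a1).
  by move: pU; rewrite UE rcons_cat.
have [_ pu4 lu4 uu4] := split_simple_path pU'.
have avu x : x \in u4 -> avoids G r x (out G).
  move=> xu4; apply: avoids_trans a2out.
  have a1a2 : avoids G r a1 a2 by apply: avoids_restrict a12.
  apply: avoids_trans a1a2.
  have ru4 : r \notin rcons u4 a1.
    apply/negP => ru4; apply: (rU r) => //.
      by rewrite UE rcons_cat mem_cat inE ru4 !orbT.
    move: pU' => /simple_pathP[z [zE _ _]]; rewrite -zE cat_uniq => /and3P[_ h _].
    rewrite UE rcons_cat !index_cat.
    have -> : (w \in u3) = false by apply/negbTE; move/hasPn: h; apply; rewrite mem_head.
    have -> : (r \in u3) = false by apply/negbTE; move/hasPn: h; apply; rewrite inE ru4 orbT.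
    rewrite ltn_add2l /= eqxx; case: eqP => // wr.
    by move: uu4; rewrite /= wr ru4.
  move: pu4 ru4 lu4; case/splitPr: xu4 => z1 z2.
  rewrite rcons_cat rcons_cons -cat_rcons cat_path last_cat last_rcons.
  move=> /andP[_ pz] rz <-; apply: avoids_path => //.
  by apply: contra rz; rewrite cat_rcons mem_cat => ->; rewrite orbT.
have : path (arrow G) a2 (v1 ++ w :: u4).
  move: pW pu4; rewrite WE -!cat_rcons !cat_path !last_rcons => /andP[-> _] /=.
  by rewrite rcons_path => /andP[].
have lastA : arrow G (last a2 (v1 ++ w :: u4)) a1.
  by move: pu4; rewrite last_cat rcons_path => /andP[].
have good x : x \in v1 ++ w :: u4 -> x \notin A /\ avoids G r x (out G).
  rewrite mem_cat inE; case/or3P => [xv|/eqP->|xu].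
  - have xW : x \in W by rewrite WE mem_cat xv.
    by split; [apply: WA|apply: avW].
  - by split; [apply: WA|apply: avW].
  split; last exact: avu.
  by apply: UA; rewrite UE mem_cat inE xu !orbT.
move=> pwalk; have lastin : last a2 (v1 ++ w :: u4) \in v1 ++ w :: u4.
  by rewrite last_cat mem_cat [last _ (_ :: _)]/= mem_last orbT.
case: (shortenP pwalk) lastA lastin => q pq uq sq lastA lastin.
exists a2, q, a1; split=> //; last by move=> x /sq /good.
split=> //; first by case/andP: uq.
have [lnA _] := good _ lastin; have := mem_last a2 q; rewrite inE => /orP[/eqP E|//].
by rewrite E a2A in lnA.
Qed.


End Appendage.

(** * Homeostasis blocks *)

Section Scc.
Variables (m : nat) (e : rel 'I_m).

(** The number of nodes from which [x] can be reached grows along edges, and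
    grows strictly between different strongly connected components.  The rank
    of the component is added to tell apart components with equal numbers. *)
Lemma scc_levels : exists lev : 'I_m -> nat,
  (forall x y, e x y -> (lev x <= lev y)%N) /\
  (forall x y, lev x = lev y <-> connect e x y && connect e y x).
Proof.
pose B x := [set z | connect e z x]%SET.
pose C x := [set z | connect e x z && connect e z x]%SET.
pose K := #|{set 'I_m}|.
(* a number written in base K *)
pose lev x := (#|B x| * K + enum_rank (C x))%N.
have sB x y : connect e x y -> B x \subset B y.
  by move=> xy; apply/fintype.subsetP => z; rewrite !inE => /connect_trans; apply.
have ltB x y : connect e x y -> ~~ connect e y x -> (#|B x| < #|B y|)%N.
  move=> xy yx; apply: proper_card; rewrite properE sB //=.
  by apply/fintype.subsetPn; exists y; rewrite inE // connect0.
have eqC x y : connect e x y && connect e y x -> C x = C y.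
  move=> /andP[xy yx]; apply/setP => z; rewrite !inE; apply/andP/andP.
    by move=> [xz zx]; rewrite (connect_trans yx xz) (connect_trans zx xy).
  by move=> [yz zy]; rewrite (connect_trans xy yz) (connect_trans zy yx).
have levE x y : connect e x y && connect e y x -> lev x = lev y.
  move=> xy; rewrite /lev (eqC _ _ xy); congr (_ * _ + _)%N.
  by case/andP: xy => xy yx; apply/eqP; rewrite eqn_leq !subset_leq_card ?sB.
exists lev; split=> x y.
  move=> /connect1 xy; have [yx|yx] := boolP (connect e y x).
    by rewrite (levE x y) // xy yx.
  rewrite /lev; apply: (@leq_trans (#|B x|.+1 * K)%N).
    by rewrite mulSn addnC leq_add2r ltnW.
  by apply: leq_trans (leq_addr _ _); rewrite leq_mul2r ltB ?orbT.
split; last exact: levE.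
rewrite /lev => /(congr1 (fun k => k %% K)%N); rewrite !modnMDl !modn_small //.
move=> /val_inj/enum_rank_inj => CE.
by have : y \in C y; [rewrite inE !connect0|rewrite -CE inE].
Qed.

End Scc.

Section Blocks.
Variables (n : nat) (G : network n).
Implicit Types (x y v r : 'I_n) (A : {set 'I_n}).

(** The diagonal block [eta] is the restriction of the Jacobian to the rows and
    columns in [A], up to permutations. *)
Definition is_block_of (s t : 'S_n.-1) (lev : 'I_n.-1 -> nat) eta A :=
  [set row_node G s i | i in block_positions lev eta]%SET = A /\
  [set col_node G t i | i in block_positions lev eta]%SET = A.

Lemma row_node_inj s : injective (row_node G s).
Proof. by move=> i j /lift_inj/perm_inj. Qed.

Lemma col_node_inj t : injective (col_node G t).
Proof. by move=> i j /lift_inj/perm_inj. Qed.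

Lemma is_block_of_subnetwork s t lev eta A : is_block_of s t lev eta A ->
  homeostasis_subnetwork G s t lev eta = full_subnetwork G A.
Proof.
move=> [rA cA]; rewrite /homeostasis_subnetwork /full_subnetwork; congr pair.
  apply/setP => v; rewrite inE; apply/exists_inP/idP.
    move=> [i iD /exists_inP[j jD /andP[_ /orP[]/eqP->]]].
      by rewrite -rA imset_f.
    by rewrite -cA imset_f.
  move=> vA; move: (vA); rewrite -{1}rA => /imsetP[i iD vi]; exists i => //.
  move: vA; rewrite -cA => /imsetP[j jD vj]; apply/exists_inP; exists j => //.
  by rewrite vi eqxx andbT /entry_nz /coupled -vi -vj eqxx.
apply/setP => -[q p]; rewrite !inE /=; apply/exists_inP/idP.
  move=> [i iD /exists_inP[j jD /and3P[eij ne /eqP[-> ->]]]].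
  rewrite -{1}cA -rA !imset_f //= eq_sym ne /=.
  by move: eij; rewrite /entry_nz /coupled (negPf ne).
move=> /and4P[]; rewrite -{1}cA -rA => /imsetP[j jD ->] /imsetP[i iD ->] ne a.
exists i => //; apply/exists_inP; exists j => //.
by rewrite /entry_nz /coupled a orbT eq_sym ne eqxx.
Qed.

(** A zero row of a block could be moved to its bottom, where it would be a
    diagonal block of size one by itself. *)
Lemma not_triangularizable_row s t lev eta i :
  not_further_triangularizable G s t lev eta -> i \in block_positions lev eta ->
  (1 < #|block_positions lev eta|)%N ->
  exists2 j, j \in block_positions lev eta & entry_nz G s t i j.
Proof.
set D := block_positions _ _ => nft iD D1.
have lt : (#|D|.-1 < #|D|)%N by rewrite prednK // ltnW.
have [|i' [j' [ci jc]]] := nft (tperm (Ordinal lt) (enum_rank_in iD i)) 1%g #|D|.-1.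
  by rewrite lt andbT -ltnS prednK // ltnW.
have -> : i' = Ordinal lt.
  by apply/val_inj/eqP; rewrite /= eqn_leq ci andbT -ltnS prednK // ltnW.
rewrite tpermL perm1 enum_rankK_in // => eij.
by exists (enum_val j') => //; apply: enum_valP.
Qed.

Lemma not_triangularizable_col s t lev eta j :
  not_further_triangularizable G s t lev eta -> j \in block_positions lev eta ->
  (1 < #|block_positions lev eta|)%N ->
  exists2 i, i \in block_positions lev eta & entry_nz G s t i j.
Proof.
set D := block_positions _ _ => nft jD D1.
have lt : (0 < #|D|)%N by rewrite ltnW.
have [|i' [j' [ci jc]]] := nft 1%g (tperm (Ordinal lt) (enum_rank_in jD j)) 1%N.
  by rewrite D1.
have -> : j' = Ordinal lt by apply/val_inj/eqP; rewrite /= -leqn0 -ltnS.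
rewrite tpermL perm1 enum_rankK_in // => eij.
by exists (enum_val i') => //; apply: enum_valP.
Qed.

(** If [A] has two nodes or more, strong connectivity provides each node of [A]
    with an arrow in and an arrow out, so that it occurs both as a row and as a
    column of the block.  No row or column of the block is zero, so
    conversely all of them are nodes of the subnetwork. *)
Lemma subnetwork_is_block_of s t lev eta A :
  homeostasis_blocks G s t lev ->
  homeostasis_subnetwork G s t lev eta = full_subnetwork G A ->
  (exists a, a \in A) ->
  (forall a b, a \in A -> b \in A -> connect (restrict G A) a b) ->
  is_block_of s t lev eta A.
Proof.
move=> [_ /(_ eta) nft] [EN EA] [a0 a0A] sc.
set D := block_positions lev eta in EN EA *.
have nodes i j : i \in D -> j \in D -> entry_nz G s t i j ->
    row_node G s i \in A /\ col_node G t j \in A.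
  move=> iD jD eij; rewrite -EN !inE; split; apply/exists_inP; exists i => //;
    by apply/exists_inP; exists j => //; rewrite eij eqxx ?orbT.
have [i0 i0D [j0 j0D e0]] : exists2 i, i \in D & exists2 j, j \in D & entry_nz G s t i j.
  move: a0A; rewrite -EN inE => /exists_inP[i iD /exists_inP[j jD /andP[eij _]]].
  by exists i => //; exists j.
have D1 : (1 < #|D|)%N \/ forall i, i \in D -> i = i0.
  have [|D1] := ltnP 1 #|D|; [by left|right=> i iD].
  have /cards1P[z Dz] : #|D| == 1%N.
    by rewrite eqn_leq D1 card_gt0; apply/set0Pn; exists i0.
  by move: iD i0D; rewrite Dz !inE => /eqP-> /eqP->.
have rowA i : i \in D -> row_node G s i \in A.
  move=> iD; case: D1 => [D1|/(_ _ iD)->]; last by have [] := nodes i0 j0 i0D j0D e0.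
  have [j jD eij] := not_triangularizable_row nft iD D1.
  by have [] := nodes i j iD jD eij.
have colA i : i \in D -> col_node G t i \in A.
  move=> iD; case: D1 => [D1|D1].
    have [j jD eij] := not_triangularizable_col nft iD D1.
    by have [] := nodes j i jD iD eij.
  by rewrite (D1 _ iD) -(D1 _ j0D); have [] := nodes i0 j0 i0D j0D e0.
have arr p q : p \in A -> q \in A -> p != q -> arrow G q p ->
    exists i j, [/\ i \in D, j \in D, p = row_node G s i & q = col_node G t j].
  move=> pA qA ne a.
  have : (q, p) \in [set e | [&& e.1 \in A, e.2 \in A, e.1 != e.2 & arrow G e.1 e.2]]%SET.
    by rewrite inE /= qA pA eq_sym ne a.
  rewrite -EA inE => /exists_inP[i iD /exists_inP[j jD /and3P[_ _ /eqP[-> ->]]]].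
  by exists i, j.
have single a : a \in A -> (forall b, b \in A -> b = a) ->
    row_node G s i0 = a /\ col_node G t i0 = a.
  by move=> aA one; split; apply: one; [apply: rowA|apply: colA].
have two a : a \in A -> (exists2 b, b \in A & b != a) \/ (forall b, b \in A -> b = a).
  move=> aA; have [/exists_inP[b bA ba]|] := boolP [exists b in A, b != a].
    by left; exists b.
  rewrite negb_exists => /forallP H; right=> b bA; apply/eqP.
  by have := H b; rewrite bA negbK.
split; apply/setP => a; apply/imsetP/idP => [[i iD ->]|aA]; try by [apply: rowA|apply: colA].
  have [[b bA ba]|one] := two a aA; last first.
    by exists i0 => //; have [] := single a aA one.
  have /(connect_restrictP G a bA)[p [pp lp up sp]] := sc b a bA aA.
  case/lastP: p pp lp up sp => [|p z]; first by move=> _ /= E; rewrite E eqxx in ba.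
  rewrite rcons_path last_rcons => /andP[_ ar] za; rewrite za in ar * => up sp.
  have lA : last b p \in A.
    have := mem_last b p; rewrite inE => /orP[/eqP->//|lp].
    by apply: sp; rewrite mem_rcons inE lp orbT.
  have ne : a != last b p.
    move: up; rewrite -rcons_cons rcons_uniq => /andP[+ _].
    by apply: contraNneq => ->; rewrite mem_last.
  by have [i [j [iD jD -> _]]] := arr a (last b p) aA lA ne ar; exists i.
have [[b bA ba]|one] := two a aA; last first.
  by exists i0 => //; have [] := single a aA one.
have /(connect_restrictP G b aA)[p [pp lp up sp]] := sc a b aA bA.
case: p pp lp up sp => [|z p]; first by move=> _ /= E; rewrite E eqxx in ba.
move=> /= /andP[ar _] _ /andP[+ _] sp; rewrite inE negb_or eq_sym => /andP[ne _].
have zA : z \in A by apply: sp; rewrite mem_head.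
by have [i [j [iD jD _ ->]]] := arr z a zA aA ne ar; exists j.
Qed.

End Blocks.

Section Existence.
Variables (n : nat) (G : network n) (A : {set 'I_n}).
Hypotheses (cG : core G) (appA : appendage_subnetwork G A).

(** A nonzero term of the determinant of the homeostasis matrix: the cycle that
    shifts an io-simple path backwards, closed by the fictitious entry
    (input, output). *)
Lemma base_matching : exists mu : {perm 'I_n}, [/\
  forall i, i != inp G -> coupled G i (mu i), mu (inp G) = out G &
  forall a, a \in A -> mu a = a].
Proof.
have [s ps] := io_path_exists cG.
have [p [sE pp lp up]] : exists p, [/\ s = inp G :: p, path (arrow G) (inp G) p,
    last (inp G) p = out G & uniq (inp G :: p)] by apply/simple_pathP.
have pi : injective (prev s) by apply: (can_inj (next_prev _)); rewrite sE.
exists (perm pi); split=> [i ii||a aA].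
- rewrite permE /coupled; have [is_|nis] := boolP (i \in s); last first.
    by rewrite prev_nth (negPf nis) eqxx.
    (* the arrow from the output to the input is added to close the cycle *)
pose e' := [rel x y | (arrow G x y) || (y == inp G)].
  have ce : cycle e' s.
    rewrite sE /= rcons_path /= eqxx orbT andbT.
    by apply: sub_path pp => x y /= ->.
  by have /= := prev_cycle ce is_; rewrite (negPf ii) orbF => ->; rewrite orbT.
- by rewrite permE sE prev_head.
rewrite permE prev_nth; case: ifP => // as_.
by case: (appendage_subnetwork_appendage appA aA); exists s.
Qed.

(** Match rows with columns by the permutation of [base_matching], so that the
    diagonal has no zero, and order the strongly connected components of the
    resulting graph [e] topologically.  A zero submatrix of a block of
    complementary dimensions would have disjoint sets of rows and columns,
    because of the diagonal, and would disconnect the component.  Finally [A]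
    is one of the components: a cycle of [e] leaving [A] would turn the
    matching into a supported permutation that does not preserve [A]. *)
Lemma homeostasis_blocks_exist : exists s t lev eta,
  homeostasis_blocks G s t lev /\ is_block_of G s t lev eta A.
Proof.
have [mu [muc muio muA]] := base_matching.
have muA' x : mu x \in A -> mu x = x by move=> /muA /perm_inj.
have iA : inp G \notin A.
  apply/negP => /(appendage_subnetwork_appendage appA); apply.
  by apply: super_simple_simple => //; apply: inp_super_simple.
pose row (i : 'I_n.-1) := lift (inp G) i.
have rowi i : row i != inp G by rewrite eq_sym neq_lift.
have gex i : {j | mu (row i) = lift (out G) j}.
  apply: cid; have : out G != mu (row i).
    by rewrite -muio (inj_eq perm_inj) eq_sym.
  by case/unlift_some => j ->; exists j.
pose g i := sval (gex i).
have gE i : lift (out G) (g i) = mu (row i) by rewrite /g; case: (gex i).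
have gi : injective g.
  move=> i j /(congr1 (lift (out G))); rewrite !gE => /perm_inj; exact: lift_inj.
pose e := [rel i j : 'I_n.-1 | coupled G (row i) (mu (row j))].
have e_refl i : e i i by apply: muc.
have [lev [lev_e levE]] := scc_levels e.
have [p pP] := sorting_perm lev.
pose s := p; pose t := (p * perm gi)%g.
have eE i j : entry_nz G s t i j = e (p i) (p j).
  by rewrite /entry_nz /row_node /col_node permM permE gE.
pose L := fun i => lev (p i).
have hb : homeostasis_blocks G s t L.
  split; first split=> i j; first exact: pP.
    by rewrite eE => lt; apply/negP => /lev_e; rewrite leqNgt lt.
  move=> eta s' t' c /andP[c0 cN]; apply: contrapT => nex.
  set D := block_positions L eta in s' t' cN nex.
  pose X := [set i : 'I_#|D| | (c <= i)%N]%SET.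
  have zero i j : i \in X -> j \notin X ->
      ~~ e (p (enum_val (s' i))) (p (enum_val (t' j))).
    rewrite !inE -ltnNge => ci jc; apply/negP => eij; apply: nex.
    by exists i, j; rewrite eE.
  have compl : (t' @: (~: X) = ~: (s' @: X))%SET.
    apply/eqP; rewrite eqEcard; apply/andP; split.
      apply/fintype.subsetP => _ /imsetP[j jX ->]; rewrite inE; apply/negP.
      move=> /imsetP[i iX ij]; rewrite inE in jX.
      by have /negP := zero i j iX jX; rewrite -ij; apply.
    rewrite [X in (_ <= X)%N]card_imset; last exact: perm_inj.
    rewrite cardsCs finset.setCK card_imset; last exact: perm_inj.
    by rewrite [X in (_ <= X)%N]cardsCs finset.setCK.
  have X0 : Ordinal cN \in X by rewrite inE /=.
  have Y0 : Ordinal (ltn_trans c0 cN) \notin X by rewrite inE /= -ltnNge.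
  pose i0 := enum_val (s' (Ordinal cN)).
  pose j0 := enum_val (t' (Ordinal (ltn_trans c0 cN))).
  have iD : i0 \in D by apply: enum_valP.
  have jD : j0 \in D by apply: enum_valP.
  have /levE/andP[ij ji] : lev (p i0) = lev (p j0).
    by move: iD jD; rewrite !inE -/(L i0) -/(L j0) => /eqP-> /eqP->.
  pose P z := [exists i in X, z == p (enum_val (s' i))].
  have Pi0 : P (p i0) by apply/exists_inP; exists (Ordinal cN).
  have Pj0 : ~~ P (p j0).
    apply/negP => /exists_inP[i iX /eqP/perm_inj/enum_val_inj E].
    have : t' (Ordinal (ltn_trans c0 cN)) \in (~: (s' @: X))%SET.
      by rewrite -compl imset_f // inE.
    by rewrite inE E imset_f.
  have [u [v [Pu nPv uv iu vj]]] := connect_exit ij Pi0 Pj0.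
  have [i iX /eqP uE] := exists_inP Pu.
  have vD : (p^-1)%g v \in D.
    rewrite inE /L permKV; move: iD; rewrite inE => /eqP <-; apply/eqP; symmetry.
    apply/levE; rewrite (connect_trans vj ji) andbT.
    by apply: (connect_trans iu); apply: connect1.
  pose w := enum_rank_in vD ((p^-1)%g v).
  have wE : p (enum_val w) = v by rewrite enum_rankK_in // permKV.
  have : w \in (t' @: (~: X))%SET.
    rewrite compl inE; apply: contra nPv => /imsetP[k kX wk].
    by apply/exists_inP; exists k => //; rewrite -wk wE.
  move=> /imsetP[k kX wk]; rewrite inE in kX.
  by have /negP := zero i k iX kX; rewrite -uE -wk wE.
have [a0 a0A] := appendage_subnetwork_neq0 appA.
have rex a : a \in A -> exists i, a = row i.
  move=> aA; have : inp G != a by apply: contraNneq iA => ->.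
  by case/unlift_some => i ->; exists i.
have [i0 i0E] := rex _ a0A.
exists s, t, L, (lev i0); split=> //.
have in_scc i j : row i \in A -> row j \in A -> connect e i j.
  move=> iA' jA'.
  have /(connect_restrictP G _ jA')[q [pq lq uq sq]] :=
    appendage_subnetwork_connect appA jA' iA'.
  elim: q j jA' pq lq sq {uq} => [|z q IH] j jA' /=.
    by move=> _ /lift_inj -> _; apply: connect0.
  move=> /andP[jz pz] lz sz; have zA : z \in A by apply: sz; rewrite mem_head.
  have [k kE] := rex _ zA.
  have ek : e k j by rewrite /= muA // /coupled -kE jz orbT.
  apply: connect_trans (@connect1 _ e k j ek); rewrite kE in pz lz zA.
  by apply: IH => // y yq; apply: sz; rewrite inE yq orbT.
have out_scc z : connect e i0 z -> connect e z i0 -> row z \in A.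
  move=> iz zi; apply/negPn/negP => zA.
  have i0A : row i0 \in A by rewrite -i0E.
  have [x [y [xA yA xy ix yz]]] := connect_exit (P := [pred i | row i \in A]) iz i0A zA.
  have yx : connect e y x.
    by apply: connect_trans yz (connect_trans zi _); apply: in_scc.
  case/connectP: yx => q0 pq0 lq0; case: (shortenP pq0) lq0 => q pq uq _ lq {q0 pq0}.
  (* the matching is shifted along a cycle of e that passes from y back to x *)
  pose c := map row (y :: q).
  have uc : uniq c by rewrite map_inj_uniq //; apply: lift_inj.
  have ni : injective (next c) by apply: (can_inj (prev_next uc)).
  pose sg := (perm ni * mu)%g.
  have sgE i : sg i = mu (next c i) by rewrite permM permE.
  have cc : cycle [rel i j | coupled G i (mu j)] c.
    rewrite -[cycle _ _]/(path _ (row y) (rcons (map row q) (row y))).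
    by rewrite -map_rcons path_map rcons_path pq -lq.
  have sgc i : i != inp G -> coupled G i (sg i).
    move=> ii; rewrite sgE; have [ic|nic] := boolP (i \in c).
      by have := next_cycle cc ic.
    by rewrite next_nth (negPf nic); apply: muc.
  have sgi : sg (inp G) = out G.
    rewrite sgE next_nth (_ : _ \in c = false) //; apply/negbTE/mapP => -[i _ E].
    by have := rowi i; rewrite -E eqxx.
  have sep : separates_from_out G (out G) A by move=> a _; rewrite avoidsNr.
  have := supported_perm_preserves appA cG sgc sgi (@out_super_simple _ G) sep
    (or_introl erefl) xA.
  rewrite sgE lq -(last_map row) next_last // => /[dup] /muA' ->.
  exact/negP.
have DE i : (i \in block_positions L (lev i0)) = (row (p i) \in A).
  rewrite inE; apply/eqP/idP => [/levE/andP[ii' i'i]|pA]; first exact: out_scc.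
  by apply/levE; rewrite !in_scc // -i0E.
split; apply/setP => a; apply/imsetP/idP.
- by move=> [i iD ->]; rewrite -/(row _) -DE.
- move=> aA; have [i iE] := rex _ aA; exists ((p^-1)%g i).
    by rewrite DE permKV -iE.
  by rewrite iE /row_node permKV.
- by move=> [i iD ->]; rewrite /col_node permM permE gE muA -?DE.
move=> aA; have [i iE] := rex _ aA; exists ((p^-1)%g i).
  by rewrite DE permKV -iE.
by rewrite /col_node permM permE gE permKV -iE muA.
Qed.

End Existence.

Local Open Scope ring_scope.

(** * Determinants and kernels *)

Section Kernel.
Variables (F : fieldType) (n : nat).
Implicit Types (J M : 'M[F]_n) (w x : 'I_n -> F) (T : {set 'I_n}).

Lemma det0_kernel M : \det M = 0 <->
  exists w, (exists i, w i != 0) /\ forall i, \sum_j M i j * w j = 0.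
Proof.
rewrite -det_tr; split=> [/eqP/det0P[v v0 vM]|[w [[i wi] wM]]].
  exists (fun i => v 0 i); split.
    by have /rV0Pn[i vi] := v0; exists i.
  move=> i; have := congr1 (fun A : 'rV_n => A 0 i) vM.
  rewrite [RHS]mxE mxE => H; rewrite -[RHS]H.
  by apply: eq_bigr => j _; rewrite mxE mulrC.
apply/eqP/det0P; exists (\row_j w j).
  by apply/rV0Pn; exists i; rewrite mxE.
apply/rowP => j; rewrite !mxE -[RHS](wM j).
by apply: eq_bigr => l _; rewrite !mxE mulrC.
Qed.

Lemma det_neq0_kernel M :
  (forall w, (forall i, \sum_j M i j * w j = 0) -> forall i, w i = 0) -> \det M != 0.
Proof.
move=> H; apply/eqP => /det0_kernel[w [[i wi] wM]].
by rewrite (H w wM) eqxx in wi.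
Qed.

Lemma kernel_det_neq0 M w : \det M != 0 -> (forall i, \sum_j M i j * w j = 0) ->
  forall i, w i = 0.
Proof.
move=> /eqP M0 wM i; apply/eqP/negPn/negP => wi; apply: M0.
by apply/det0_kernel; exists w; split=> //; exists i.
Qed.

Lemma det_neq0_solve M (b : 'I_n -> F) : \det M != 0 ->
  exists x, forall i, \sum_j M i j * x j = b i.
Proof.
move=> M0; have Mu : M \in unitmx by rewrite unitmxE unitfE.
exists (fun j => (invmx M *m \col_i b i) j 0) => i.
have : M *m (invmx M *m \col_i b i) = \col_i b i by rewrite mulKVmx.
by move/(congr1 (fun A : 'cV_n => A i 0)); rewrite mxE [in RHS]mxE.
Qed.

Definition rowsel T J := \matrix_(i, j) if i \in T then J i j else (i == j)%:R.

(** [setrow a b J] is the matrix whose determinant is the cofactor of [J] at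
    [(a, b)]. *)
Definition setrow (a b : 'I_n) J := \matrix_(i, j) if i == a then (j == b)%:R else J i j.

Lemma sum_delta (i : 'I_n) w : \sum_j (i == j)%:R * w j = w i.
Proof.
rewrite (bigD1 i) //= eqxx mul1r big1 ?addr0 // => j ji.
by rewrite eq_sym (negPf ji) mul0r.
Qed.

Lemma sum_delta' (i : 'I_n) w : \sum_j (j == i)%:R * w j = w i.
Proof. by rewrite -[RHS]sum_delta; apply: eq_bigr => j _; rewrite eq_sym. Qed.

Lemma rowsel_row T J w i :
  \sum_j rowsel T J i j * w j = if i \in T then \sum_j J i j * w j else w i.
Proof.
case: ifP => iT; last rewrite -[RHS]sum_delta;
  by apply: eq_bigr => j _; rewrite mxE iT.
Qed.

Lemma setrow_row a b J w i :
  \sum_j setrow a b J i j * w j = if i == a then w b else \sum_j J i j * w j.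
Proof.
case: ifP => ia; last by apply: eq_bigr => j _; rewrite mxE ia.
by rewrite -[RHS]sum_delta'; apply: eq_bigr => j _; rewrite mxE ia.
Qed.

Lemma sum_image (I : finType) (c : I -> 'I_n) T h : injective c ->
  [set c y | y in I]%SET = T -> (forall j, j \notin T -> h j = 0) ->
  \sum_j h j = \sum_y h (c y) :> F.
Proof.
move=> ci cT hT; rewrite (bigID (mem T)) /= [X in _ + X]big1 //.
by rewrite addr0 -cT big_imset //=; move=> x y _ _; apply: ci.
Qed.

End Kernel.

Section Block.
Variables (R : realType) (n : nat) (G : network n).
Implicit Types (J : 'M[R]_n) (A : {set 'I_n}).

(** Both determinants vanish exactly when some nonzero vector supported in [A]
    is annihilated by the rows of [J] in [A]. *)
Lemma is_block_of_det s t lev eta A J : is_block_of G s t lev eta A ->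
  \det (homeostasis_block G s t lev eta J) = 0 <-> \det (rowsel A J) = 0.
Proof.
move=> [rA cA].
set D := block_positions lev eta in rA cA.
pose r (x : 'I_#|D|) := row_node G s (enum_val x).
pose c (x : 'I_#|D|) := col_node G t (enum_val x).
have ri : injective r by move=> x y /row_node_inj/enum_val_inj.
have ci : injective c by move=> x y /col_node_inj/enum_val_inj.
have img (f : 'I_n.-1 -> 'I_n) : [set f (enum_val x) | x in 'I_#|D|]%SET =
    [set f i | i in D]%SET.
  apply/setP => a; apply/imsetP/imsetP => [[x _ ->]|[i iD ->]].
    by exists (enum_val x) => //; apply: enum_valP.
  by exists (enum_rank_in iD i) => //; rewrite enum_rankK_in.
have {}rA : [set r x | x in 'I_#|D|]%SET = A by rewrite -rA -img.
have {}cA : [set c x | x in 'I_#|D|]%SET = A by rewrite -cA -img.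
have BE x y : homeostasis_block G s t lev eta J x y = J (r x) (c y).
  by rewrite !mxE.
split=> /det0_kernel[v [[i0 vi0] vJ]]; apply/det0_kernel.
  pose w j := if [pick y | c y == j] is Some y then v y else 0.
  have wc y : w (c y) = v y.
    rewrite /w; case: pickP => [z /eqP/ci->//|/(_ y)]; by rewrite eqxx.
  have wA j : j \notin A -> w j = 0.
    rewrite /w; case: pickP => // z /eqP <-; by rewrite -cA imset_f.
  exists w; split; first by exists (c i0); rewrite wc.
  move=> i; rewrite rowsel_row; case: ifP => iA; last by apply: wA; rewrite iA.
  move: iA; rewrite -rA => /imsetP[x _ ->]; rewrite -[RHS](vJ x).
  rewrite (sum_image ci cA); last by move=> j /wA ->; rewrite mulr0.
  by apply: eq_bigr => y _; rewrite wc BE.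
have wA j : j \notin A -> v j = 0.
  by move=> jA; have := vJ j; rewrite rowsel_row (negPf jA).
exists (fun y => v (c y)); split.
  have : i0 \in A by apply: contraNT vi0 => /wA ->.
  by rewrite -cA => /imsetP[y _ E]; exists y; rewrite -E.
move=> x; have := vJ (r x); rewrite rowsel_row -{1}rA imset_f //.
rewrite (sum_image ci cA); last by move=> j /wA ->; rewrite mulr0.
by move=> H; rewrite -[RHS]H; apply: eq_bigr => y _; rewrite BE.
Qed.

(** Erasing the entries between [A] and its complement changes no term of the
    determinant, since every nonzero term preserves [A].  What remains is block
    diagonal with a singular block. *)
Lemma det_setrow_eq0 A k J : supported G J -> inp G \notin A ->
  (forall s : {perm 'I_n}, (forall i, i != inp G -> coupled G i (s i)) ->
     s (inp G) = k -> forall a, a \in A -> s a \in A) ->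
  \det (rowsel A J) = 0 -> \det (setrow (inp G) k J) = 0.
Proof.
move=> sJ iA pres /det0_kernel[w [wN0 wJ]].
set N := setrow _ _ _.
pose Z := \matrix_(i, j) if (i \in A) == (j \in A) then N i j else 0.
have -> : \det N = \det Z.
  rewrite /determinant; apply: eq_bigr => s _; congr (_ * _).
  have [/existsP[i /eqP Ni]|] := boolP [exists i, N i (s i) == 0].
    have Zi : Z i (s i) = 0 by rewrite mxE Ni if_same.
    by rewrite (bigD1 i) //= Ni mul0r (bigD1 i) //= Zi mul0r.
  rewrite negb_exists => /forallP NN; apply: eq_bigr => i _.
  rewrite [RHS]mxE perm_preserves_complement ?eqxx //; apply: pres => [j ji|].
    have := NN j; rewrite mxE (negPf ji); apply: contraNT => /sJ ->; by rewrite eqxx.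
  by have := NN (inp G); rewrite mxE eqxx; case: (s _ =P k) => //; rewrite eqxx.
have wA j : j \notin A -> w j = 0.
  by move=> jA; have := wJ j; rewrite rowsel_row (negPf jA).
apply/det0_kernel; exists w; split=> // i.
have [iiA|iiA] := boolP (i \in A); last first.
  apply: big1 => j _; have [jA|/wA->] := boolP (j \in A); last by rewrite mulr0.
  by rewrite mxE (negPf iiA) jA mul0r.
have := wJ i; rewrite rowsel_row iiA => H; rewrite -[RHS]H; apply: eq_bigr => j _.
have [jA|/wA->] := boolP (j \in A); last by rewrite !mulr0.
rewrite mxE iiA jA eqxx mxE; case: eqP => // E.
by move: iA; rewrite -E iiA.
Qed.

(** A kernel vector [u] of the modified matrix satisfies [u k = 0], and [J u] is
    a nonzero multiple of the basis vector of the input.  So the solution [x]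
    is a multiple of [u]. *)
Lemma cramer_eq0 J k c (x : 'I_n -> R) : \det J != 0 ->
  (forall i, \sum_j J i j * x j = - (c * (i == inp G)%:R)) ->
  \det (setrow (inp G) k J) = 0 -> x k = 0.
Proof.
move=> J0 Jx /det0_kernel[u [[i0 ui0] uN]].
have uk : u k = 0 by have := uN (inp G); rewrite setrow_row eqxx.
have uJ i : i != inp G -> \sum_j J i j * u j = 0.
  by move=> ii; have := uN i; rewrite setrow_row (negPf ii).
set b := \sum_j J (inp G) j * u j.
have b0 : b != 0.
  apply/eqP => b0; move: ui0; rewrite (@kernel_det_neq0 _ _ _ u J0) ?eqxx // => i.
  by have [->|] := eqVneq i (inp G); [|apply: uJ].
have H := @kernel_det_neq0 _ _ J (fun j => x j + c / b * u j) J0.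
have /(_ _ k) := H; rewrite uk mulr0 addr0; apply=> i.
under eq_bigr => j _ do rewrite mulrDr mulrCA.
rewrite big_split /= -mulr_sumr Jx; have [->|ii] := eqVneq i (inp G).
  by rewrite -/b mulr1 mulfVK // addNr.
by rewrite uJ // !mulr0 oppr0 addr0.
Qed.

Lemma cramer_neq0 J k c (x : 'I_n -> R) : c != 0 ->
  (forall i, \sum_j J i j * x j = - (c * (i == inp G)%:R)) ->
  \det (setrow (inp G) k J) != 0 -> x k != 0.
Proof.
move=> c0 Jx N0; apply/eqP => xk; have := Jx (inp G); rewrite eqxx mulr1 big1.
  by move/esym/eqP; rewrite oppr_eq0 (negPf c0).
move=> j _; rewrite (@kernel_det_neq0 _ _ _ x N0) ?mulr0 // => i.
by rewrite setrow_row Jx; case: eqP; rewrite ?mulr0 ?oppr0.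
Qed.

End Block.

(** * Derivative of a family of equilibria *)

Section Norms.
Variables (R : realType) (n : nat).

Lemma row_norm_le (v : 'rV[R]_n) e : 0 <= e -> (forall i, `|v 0 i| <= e) -> `|v| <= e.
Proof.
move=> e0 H; rewrite [leLHS]/Num.norm /= mx_normrE.
by apply: bigmax_le => // -[i j] _ /=; rewrite [i]ord1.
Qed.

Lemma row_norm_ge (v : 'rV[R]_n) i : `|v 0 i| <= `|v|.
Proof.
rewrite [leRHS]/Num.norm /= mx_normrE.
by apply/bigmax_geP; right; exists (0, i).
Qed.

Lemma invertible_bound (J : 'M[R]_n) : \det J != 0 ->
  exists2 K, 0 < K & forall (y : 'rV[R]_n) d, 0 <= d ->
    (forall j, `|\sum_l J j l * y 0 l| <= d) -> `|y| <= K * d.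
Proof.
move=> J0; have Ju : J \in unitmx by rewrite unitmxE unitfE.
pose K := 1 + \sum_k \sum_j `|invmx J k j|.
have K0 k : 0 <= \sum_j `|invmx J k j| by apply: sumr_ge0.
exists K; first by rewrite ltr_pwDl // sumr_ge0.
move=> y d d0 H; apply: row_norm_le => [|k].
  by rewrite mulr_ge0 // addr_ge0 // sumr_ge0.
have -> : y 0 k = \sum_j invmx J k j * (\sum_l J j l * y 0 l).
  have : y^T = invmx J *m (J *m y^T) by rewrite mulKmx.
  move/(congr1 (fun A : 'cV_n => A k 0)); rewrite mxE => ->.
  rewrite mxE; apply: eq_bigr => j _; congr (_ * _).
  by rewrite mxE; apply: eq_bigr => l _; rewrite mxE.
apply: (le_trans (ler_norm_sum _ _ _)).
apply: (@le_trans _ _ (\sum_j `|invmx J k j| * d)).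
  by apply: ler_sum => j _; rewrite normrM ler_wpM2l.
rewrite -mulr_suml ler_wpM2r // /K [X in _ <= 1 + X](bigD1 k) //=.
rewrite addrCA lerDl addr_ge0 // sumr_ge0 //.
Qed.

End Norms.

(** Reduces partial derivatives, with the other variables frozen, to
    directional derivatives of a function of all the variables. *)
Lemma derive_along_line (R : realType) (V1 V2 : normedModType R)
    (f1 : V1 -> R) (f2 : V2 -> R) a1 v1 a2 v2 :
  (forall t, f1 (t *: v1 + a1) = f2 (t *: v2 + a2)) -> 'D_v1 f1 a1 = 'D_v2 f2 a2.
Proof.
move=> H; have H0 : f1 a1 = f2 a2 by have := H 0; rewrite !scale0r !add0r.
have E : (fun h : R => h^-1 *: ((f1 \o shift a1) (h *: v1) - f1 a1)) =
         (fun h : R => h^-1 *: ((f2 \o shift a2) (h *: v2) - f2 a2)).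
  by apply/funext => t; rewrite /= H H0.
by rewrite /derive E.
Qed.

Section Family.
Variables (R : realType) (n : nat) (G : network n).
Variables (f : vector_field R n) (X0 : 'rV[R]_n) (I0 : R) (X : R -> 'rV[R]_n).
Hypotheses (adm : admissible G f) (hyp : hyperbolic_equilibrium f X0 I0).
Hypothesis fam : equilibrium_family f X0 I0 X.

Local Notation J := (jac f X0 I0).
Local Notation c := (input_deriv G f X0 I0).
Let F j (z : 'rV[R]_n * R) : R := f z.1 z.2 0 j.

Lemma hyperbolic_det (M : 'M[R]_n) : hyperbolic M -> \det M != 0.
Proof.
move=> H; apply/eqP => M0; have /eqP/det0P[v v0 vM] := M0.
have /H : eigenvalue (map_mx (complex.real_complex R) M) 0.
  apply/eigenvalueP; exists (map_mx (complex.real_complex R) v).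
    by rewrite -map_mxM vM map_mx0 scale0r.
  by rewrite map_mx_eq0.
by rewrite eqxx.
Qed.

Let dF j : differentiable (F j) (X0, I0).
Proof. by case: adm => /(_ j [::] (X0, I0)). Qed.

Lemma diff_field j (v : 'rV[R]_n) h :
  'd (F j) (X0, I0) (v, h) = \sum_l J j l * v 0 l + c * (j == inp G)%:R * h.
Proof.
have JE l : J j l = 'd (F j) (X0, I0) (delta_mx 0 l, 0).
  rewrite mxE -deriveE; last exact: (dF j).
  by apply: derive_along_line => t; rewrite /F /= scaler0 add0r.
have cE : 'd (F j) (X0, I0) (0, 1) = c * (j == inp G)%:R.
  rewrite -deriveE; last exact: (dF j).
  have -> : 'D_(0, 1) (F j) (X0, I0) = 'D_1 (fun I => f X0 I 0 j) I0.
    by apply: derive_along_line => t; rewrite /F /= scaler0 add0r.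
  have [->|ji] := eqVneq j (inp G); first by rewrite mulr1 /input_deriv derive1E.
  rewrite mulr0; have [_ /(_ j ji) cst _ _] := adm.
  have -> : (fun I => f X0 I 0 j) = (fun=> f X0 I0 0 j) by apply/funext => I; apply: cst.
  exact: derive_cst.
have -> : (v, h) = \sum_l v 0 l *: (delta_mx 0 l, 0) + h *: (0, 1) :> 'rV[R]_n * R.
  have -> : \sum_l v 0 l *: (delta_mx 0 l, 0) = (v, 0) :> 'rV[R]_n * R.
    rewrite [v in RHS]row_sum_delta.
    elim/big_rec2: _ => [//|l a b _ ->]; by congr pair; rewrite /= ?scaler0 ?add0r.
  by congr pair; rewrite /= ?scaler0 ?addr0 ?add0r // [h *: _]mulr1.
rewrite linearD linear_sum linearZ /= cE; congr (_ + _); last exact: mulrC.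
by apply: eq_bigr => l _; rewrite linearZ /= -JE mulrC.
Qed.

(** The differentiability part of the implicit function theorem for a family
    that is already known to be continuous.  With
    [y = X(I0 + h) - X0 - h x], the first-order expansion of the vector field
    gives [J y = o(|y| + |h|)], and invertibility of [J] turns this into
    [y = o(h)]. *)
Lemma equilibrium_family_derive (x : 'I_n -> R) :
  (forall i, \sum_j J i j * x j = - (c * (i == inp G)%:R)) ->
  forall k, is_derive I0 1 (fun I => X I 0 k) (x k).
Proof.
move=> xJ k; have [fX0 /hyperbolic_det J0] := hyp.
have [XI0 Xc Xeq] := fam.
have [K K0 HK] := invertible_bound J0.
pose xr : 'rV[R]_n := \row_j x j.
suff H : ((fun h => h^-1 *: (((fun I => X I 0 k) \o shift I0) (h *: 1) - X I0 0 k))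
    @ 0^' --> x k)%classic.
  apply: DeriveDef; first by apply/cvg_ex; exists (x k).
  exact/cvg_lim.
apply/cvgrPdist_le => e e0.
pose m := `|xr| + 1; have m0 : 0 < m by rewrite ltr_pwDr.
(* The first bound absorbs |y| in the left-hand side, the second one makes the
   remainder smaller than |h| * e / 2. *)
pose eps := Num.min (2^-1 / K) (e / 2 / m / K).
have eps0 : 0 < eps by rewrite lt_min !divr_gt0.
pose Z h := (X (h + I0) - X0, h).
have Xc0 : ((fun h => X (h + I0) - X0) @ 0 --> (0 : 'rV[R]_n))%classic.
  rewrite -(subrr X0); apply: cvgB; last exact: cvg_cst.
  have XC : (X @ I0 --> X0)%classic by rewrite -[X in (_ --> X)%classic]XI0; exact: Xc.
  by move: XC; rewrite -{1}[I0]add0r -cvg_comp_shift.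
have Zc : (Z @ 0 --> (0 : 'rV[R]_n * R))%classic.
  exact: (cvg_pair Xc0 (@cvg_id _ (nbhs (0 : R)))).
pose P j h := `|F j (Z h + (X0, I0)) - (F j (X0, I0) + 'd (F j) (X0, I0) (Z h))|
  <= eps * `|Z h|.
have near1 : \forall h \near 0, forall j, P j h.
  have Pj j : nbhs (0 : R) (P j).
    have /eqaddoP/(_ _ eps0) H := diff_locally (dF j).
    by have := Zc _ H.
  have H := @filter_forall R 'I_n (fun j h => P j h) (nbhs (0 : R)) _ Pj.
  exact: H.
have near2 : \forall h \near 0, f (X (h + I0)) (h + I0) = 0.
  by have := Xeq; rewrite (near_shift 0) subr0.
rewrite near_withinE; near=> h => h0 /=.
have [n1 n2] : (forall j, P j h) /\ f (X (h + I0)) (h + I0) = 0.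
  by split; [near: h; exact: near1|near: h; exact: near2].
pose y : 'rV[R]_n := X (h + I0) - X0 - h *: xr.
have yE l : y 0 l = (X (h + I0) - X0) 0 l - h * x l by rewrite !mxE.
have Jy j : \sum_l J j l * y 0 l = 'd (F j) (X0, I0) (Z h).
  rewrite diff_field; under eq_bigr => l _ do rewrite yE mulrBr.
  rewrite sumrB; congr (_ + _).
  under eq_bigr => l _ do rewrite mulrCA.
  by rewrite -mulr_sumr xJ mulrN opprK mulrC.
have Zn : `|Z h| <= `|y| + `|h| * m.
  have -> : `|Z h| = Num.max `|X (h + I0) - X0| `|h| by [].
  rewrite ge_max; apply/andP; split.
    have -> : X (h + I0) - X0 = y + h *: xr by rewrite /y subrK.
    apply: (le_trans (ler_normD _ _)); rewrite lerD2l normrZ ler_wpM2l //.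
    by rewrite /m lerDl.
  by rewrite ler_wpDl // ler_peMr // /m lerDr.
have yle : `|y| <= K * (eps * (`|y| + `|h| * m)).
  apply: HK => [|j].
    apply: mulr_ge0; first exact: ltW.
    by apply: addr_ge0 => //; apply: mulr_ge0 => //; exact: ltW.
  rewrite Jy; apply: le_trans (ler_wpM2l (ltW eps0) Zn).
  have F0 : F j (X0, I0) = 0 by rewrite /F fX0 mxE.
  have F1 : F j (Z h + (X0, I0)) = 0 by rewrite /F /= subrK n2 mxE.
  by have := n1 j; rewrite /P F0 F1 !add0r normrN.
have hn0 : 0 < `|h| by rewrite normr_gt0.
have Ke : K * eps <= 2^-1.
  by rewrite mulrC -ler_pdivlMr // /eps ge_min lexx.
have Kem : K * eps * m <= e / 2.
  rewrite -ler_pdivlMr // mulrC -ler_pdivlMr //.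
  by rewrite /eps ge_min lexx orbT.
have y0 : 0 <= `|y| by [].
have yh : `|y| <= `|h| * e.
  have : K * (eps * (`|y| + `|h| * m)) <= 2^-1 * `|y| + `|h| * (e / 2).
    rewrite mulrA mulrDr lerD //; first exact: ler_wpM2r.
    by rewrite mulrCA ler_wpM2l.
  move/(le_trans yle) => yle2; rewrite -subr_ge0; move: yle2; rewrite -subr_ge0.
  set a := `|y|; set b := `|h| => H; lra.
have hh : h%:A = h by rewrite [h%:A]mulr1.
have -> : x k - h^-1 *: (X (h *: 1 + I0) 0 k - X I0 0 k) = - (h^-1 * y 0 k).
  rewrite yE XI0 [h *: 1]mulr1 !mxE [_ *: _]/(_ * _).
  by rewrite [in RHS]mulrBr mulKf // opprB.
rewrite normrN normrM normfV mulrC ler_pdivrMr // mulrC.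
exact: le_trans (row_norm_ge y k) yh.
Unshelve. all: by end_near. Qed.

Lemma equilibrium_family_homeostatic k :
  \det (setrow (inp G) k J) = 0 -> homeostatic X I0 k.
Proof.
move=> N0; have [_ /hyperbolic_det J0] := hyp.
have [x xJ] := det_neq0_solve (fun i => - (c * (i == inp G)%:R)) J0.
rewrite /homeostatic -(cramer_eq0 J0 xJ N0).
exact: equilibrium_family_derive.
Qed.

End Family.

(** * Nodes induced by an appendage subnetwork *)

Section Positive.
Variables (R : realType) (n : nat) (G : network n) (A : {set 'I_n}).
Hypotheses (cG : core G) (appA : appendage_subnetwork G A).

Lemma inp_notin_appendage_subnetwork : inp G \notin A.
Proof.
apply/negP => /(appendage_subnetwork_appendage appA); apply.
by apply: super_simple_simple => //; apply: inp_super_simple.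
Qed.

Lemma eval_at1 (J : 'M[R]_n) c : eval_at (mpoly.mpolyC (n * n + 1) (1 : R)) J c = 1.
Proof. by rewrite /eval_at mpoly.mevalC. Qed.

Lemma jac_supported f (X0 : 'rV[R]_n) I0 : admissible G f -> supported G (jac f X0 I0).
Proof.
move=> [_ _ _ H] j l; rewrite negb_or => /andP[jl nar].
by have [_ /(_ nar)] := H j l jl; apply.
Qed.

(** The constant polynomial 1 serves as exceptional polynomial: the conclusion
    holds without exception. *)
Lemma separates_induces r k : super_simple G r -> separates_from_out G r A ->
  k = r \/ avoids G r k (out G) -> induces R G (full_subnetwork G A) k.
Proof.
move=> ssr sep kr; have [s [t [lev [eta [hb ib]]]]] := homeostasis_blocks_exist cG appA.
exists s, t, lev, eta; split=> //; first exact: is_block_of_subnetwork.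
exists (mpoly.mpolyC (n * n + 1) 1); split.
  exists 0, 0; split; first by move=> j l _; rewrite mxE.
    apply/(is_block_of_det _ ib)/det0_kernel.
    have [a aA] := appendage_subnetwork_neq0 appA.
    exists (fun j => (a == j)%:R); split; first by exists a; rewrite eqxx oner_eq0.
    move=> i; rewrite rowsel_row; case: ifP => iA.
      by apply: big1 => j _; rewrite mxE mul0r.
    by case: eqP aA => // ->; rewrite iA.
  by rewrite eval_at1; apply/eqP/oner_neq0.
move=> f X0 I0 X adm hyp fam det0 _; apply: (equilibrium_family_homeostatic adm hyp fam).
apply: (@det_setrow_eq0 _ _ _ A) => //.
- exact: jac_supported.
- exact: inp_notin_appendage_subnetwork.
- move=> p pc pk a aA; exact: (supported_perm_preserves appA cG pc pk ssr sep kr aA).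
- exact/(is_block_of_det _ ib).
Qed.

End Positive.

(** * Linear systems *)

Section LinearSystem.
Variables (R : realType) (n : nat) (G : network n) (J : 'M[R]_n) (c : R).

Definition linear_system : vector_field R n :=
  fun X I => X *m J^T + (c * I) *: delta_mx 0 (inp G).

Lemma linear_systemE X I j :
  linear_system X I 0 j = \sum_l J j l * X 0 l + c * (j == inp G)%:R * I.
Proof.
rewrite !mxE eqxx /= mulrAC; congr (_ + _).
by apply: eq_bigr => l _; rewrite mxE mulrC.
Qed.

Lemma linear_system_differentiable j z :
  differentiable (fun z : 'rV[R]_n * R => linear_system z.1 z.2 0 j : R) z.
Proof.
have -> : (fun z : 'rV[R]_n * R => linear_system z.1 z.2 0 j : R)
    = (\sum_l (J j l *: (fun z : 'rV[R]_n * R => z.1 0 l : R))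
        + (c * (j == inp G)%:R) *: (snd : 'rV[R]_n * R -> R)).
  by apply/funext => y; rewrite linear_systemE fctE /= fct_sumE.
have d1 : differentiable (@fst 'rV[R]_n R) z.
  by apply: linear_differentiable => y; apply: cvg_fst.
have d2 : differentiable (@snd 'rV[R]_n R) z.
  by apply: linear_differentiable => y; apply: cvg_snd.
apply: differentiableD; last exact: differentiableZ.
apply: differentiable_sum => l; apply: differentiableZ.
exact: (differentiable_comp d1 (@differentiable_coord _ _ _ _ _ _)).
Qed.

(** A linear function is its own differential. *)
Lemma linear_system_derive j v z :
  'D_v (fun z : 'rV[R]_n * R => linear_system z.1 z.2 0 j : R) z =
  linear_system v.1 v.2 0 j.
Proof.
set g := fun z => _.
have glin : linear g.
  move=> t u w; rewrite /g !linear_systemE /= -[X in _ = X + _]/(t * (_ + _)).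
  rewrite [t *: u.2]/(t * u.2).
  rewrite mulrDr [t * (_ + _)]mulrDr [t * (c * _ * _)]mulrCA [RHS]addrACA.
  congr (_ + _); rewrite mulr_sumr -big_split /=; apply: eq_bigr => l _.
  by rewrite !mxE mulrDr mulrCA.
pose glM := GRing.isLinear.Build _ _ _ _ _ glin.
pose gL : {linear _ -> _} := HB.pack g glM.
rewrite deriveE; last exact: linear_system_differentiable.
rewrite (@diff_lin _ _ _ gL) // => y.
exact/differentiable_continuous/linear_system_differentiable.
Qed.

Lemma linear_system_smooth j :
  smooth (fun z : 'rV[R]_n * R => linear_system z.1 z.2 0 j).
Proof.
set g := fun z => _; move=> vs z.
have : foldr (fun v (h : _ -> R) => 'D_v h) g vs = g \/
   exists a, foldr (fun v (h : _ -> R) => 'D_v h) g vs = cst a.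
  elim: vs => [|v vs]; [by left|move=> IH; right].
  have {IH} [E|[a E]] := IH; rewrite /= E.
    by exists (g v); apply/funext => y; rewrite linear_system_derive.
  by exists 0; apply/funext => y; rewrite derive_cst.
case=> [->|[a ->]]; first exact: linear_system_differentiable.
exact: differentiable_cst.
Qed.

Lemma linear_system_jac X I : jac linear_system X I = J.
Proof.
apply/matrixP => j l; rewrite mxE.
rewrite (@derive_along_line _ _ _ _
  (fun z : 'rV[R]_n * R => linear_system z.1 z.2 0 j) _ _ (X, I) (delta_mx 0 l, 0)).
  rewrite linear_system_derive linear_systemE /= mulr0 addr0.
  rewrite -[RHS](sum_delta' l (fun i => J j i)).
  by apply: eq_bigr => i _; rewrite mxE eqxx mulrC.
by move=> t; rewrite /= scaler0 add0r.
Qed.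

Lemma linear_system_input_deriv X I : input_deriv G linear_system X I = c.
Proof.
rewrite /input_deriv derive1E.
rewrite (@derive_along_line _ _ _ _
  (fun z : 'rV[R]_n * R => linear_system z.1 z.2 0 (inp G)) _ _ (X, I) (0, 1)).
  rewrite linear_system_derive linear_systemE /= eqxx !mulr1 big1 ?add0r // => l _.
  by rewrite mxE mulr0.
by move=> t; rewrite /= scaler0 add0r.
Qed.

Hypotheses (Js : supported G J) (hJ : hyperbolic J).
Hypothesis Ja : forall j l, j != l -> arrow G l j -> J j l != 0.

Lemma linear_system_admissible : admissible G linear_system.
Proof.
split=> [j|j ji X I I'|j X Y I XYj XY|j l jl].
- exact: linear_system_smooth.
- by rewrite !linear_systemE (negPf ji) mulr0 !mul0r.
- rewrite !linear_systemE; congr (_ + _); apply: eq_bigr => l _.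
  have [/orP[/eqP<-|a]|/Js->] := boolP (coupled G j l); last by rewrite !mul0r.
    by rewrite XYj.
  by rewrite XY.
split=> [H|a X I]; last by rewrite linear_system_jac Js // negb_or jl.
apply/negP => a; have := Ja jl a; rewrite -(linear_system_jac 0 0) H.
by rewrite eqxx.
Qed.

(** The family of equilibria of the linear system through the origin is the line
    spanned by the solution [x] of [J x = - c e_iota]. *)
Lemma linear_system_not_homeostatic k : c != 0 -> \det (setrow (inp G) k J) != 0 ->
  exists X, [/\ hyperbolic_equilibrium linear_system 0 0,
    equilibrium_family linear_system 0 0 X & ~ homeostatic X 0 k].
Proof.
move=> c0 N0; have J0 := hyperbolic_det hJ.
have [x xJ] := det_neq0_solve (fun i => - (c * (i == inp G)%:R)) J0.
pose X I : 'rV[R]_n := I *: \row_j x j.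
have fX I : linear_system (X I) I = 0.
  apply/rowP => j; rewrite linear_systemE [RHS]mxE.
  under eq_bigr => l _ do rewrite !mxE mulrCA.
  by rewrite -mulr_sumr xJ mulrN [I * _]mulrC addNr.
have hyp : hyperbolic_equilibrium linear_system 0 0.
  by split; [have := fX 0; rewrite /X scale0r|rewrite linear_system_jac].
have fam : equilibrium_family linear_system 0 0 X.
  split; first by rewrite /X scale0r.
    exact: scalel_continuous.
  exact: (@filterE _ (nbhs (0 : R)) _ _ fX).
exists X; split=> // Hk.
have H := @equilibrium_family_derive _ _ G _ _ _ _ linear_system_admissible hyp fam x.
rewrite linear_system_jac linear_system_input_deriv in H.
have := cramer_neq0 c0 xJ N0; rewrite -(@derive_val _ _ _ _ _ _ _ (H xJ k)).
by rewrite (@derive_val _ _ _ _ _ _ _ Hk) eqxx.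
Qed.

End LinearSystem.

(** * Irreducibility of the locus where a block is singular *)

Section RowLinear.
Variables (F : comNzRingType) (n : nat).
Implicit Types M B C : 'M[F]_n.

Lemma det_row_linear M B C a x y :
  (forall j, M a j = x * B a j + y * C a j) ->
  (forall i j, i != a -> B i j = M i j) -> (forall i j, i != a -> C i j = M i j) ->
  \det M = x * \det B + y * \det C.
Proof.
move=> Ma BM CM; apply: (determinant_multilinear (i0 := a)).
- by apply/rowP => j; rewrite !mxE Ma.
- by apply/matrixP => i j; rewrite !mxE BM // eq_sym neq_lift.
- by apply/matrixP => i j; rewrite !mxE CM // eq_sym neq_lift.
Qed.

End RowLinear.

Section PolyFun.
Variable R : realType.

(** Polynomial functions of one real parameter, as a predicate on functions, so
    that determinants and multivariate polynomials along a curve can be treated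
    without naming their coefficients. *)
Definition polyfun (h : R -> R) := exists q : {poly R}, forall t, h t = q.[t].

Lemma polyfun_ext h h' : (forall t, h t = h' t) -> polyfun h -> polyfun h'.
Proof. by move=> hh [q qE]; exists q => t; rewrite -hh. Qed.

Lemma polyfun_cst a : polyfun (fun=> a).
Proof. by exists a%:P => t; rewrite hornerC. Qed.

Lemma polyfun_id : polyfun id.
Proof. by exists 'X => t; rewrite hornerX. Qed.

Lemma polyfunD g h : polyfun g -> polyfun h -> polyfun (fun t => g t + h t).
Proof. by move=> [p pE] [q qE]; exists (p + q) => t; rewrite hornerD pE qE. Qed.

Lemma polyfunN g : polyfun g -> polyfun (fun t => - g t).
Proof. by move=> [p pE]; exists (- p) => t; rewrite hornerN pE. Qed.

Lemma polyfunM g h : polyfun g -> polyfun h -> polyfun (fun t => g t * h t).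
Proof. by move=> [p pE] [q qE]; exists (p * q) => t; rewrite hornerM pE qE. Qed.

Lemma polyfunX g k : polyfun g -> polyfun (fun t => g t ^+ k).
Proof. by move=> [p pE]; exists (p ^+ k) => t; rewrite horner_exp pE. Qed.

Lemma polyfun_sum (I : Type) (r : seq I) (P : pred I) (h : I -> R -> R) :
  (forall i, polyfun (h i)) -> polyfun (fun t => \sum_(i <- r | P i) h i t).
Proof.
move=> H; elim: r => [|i r IH].
  by apply: polyfun_ext (polyfun_cst 0) => t; rewrite big_nil.
have [Pi|nPi] := boolP (P i).
  by apply: polyfun_ext (polyfunD (H i) IH) => t; rewrite big_cons Pi.
by apply: polyfun_ext IH => t; rewrite big_cons (negPf nPi).
Qed.

Lemma polyfun_prod (I : Type) (r : seq I) (P : pred I) (h : I -> R -> R) :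
  (forall i, polyfun (h i)) -> polyfun (fun t => \prod_(i <- r | P i) h i t).
Proof.
move=> H; elim: r => [|i r IH].
  by apply: polyfun_ext (polyfun_cst 1) => t; rewrite big_nil.
have [Pi|nPi] := boolP (P i).
  by apply: polyfun_ext (polyfunM (H i) IH) => t; rewrite big_cons Pi.
by apply: polyfun_ext IH => t; rewrite big_cons (negPf nPi).
Qed.

Lemma poly_nonroot (p : {poly R}) : p != 0 -> exists t, p.[t] != 0.
Proof.
move=> p0; apply: contrapT => H.
pose s : seq R := [seq i%:R | i <- iota 0 (size p)].
have us : uniq s by rewrite map_inj_uniq ?iota_uniq // => i j /eqP; rewrite eqr_nat => /eqP.
have rs : all (root p) s.
  apply/allP => x _; rewrite rootE; apply/negPn/negP => px; apply: H; by exists x.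
by have := max_poly_roots p0 rs us; rewrite size_map size_iota ltnn.
Qed.

Lemma polyfun_neq0 h a : polyfun h -> h a != 0 ->
  exists2 q : {poly R}, q != 0 & forall t, h t = q.[t].
Proof.
move=> [q qE] ha; exists q => //; apply: contraNneq ha => q0.
by rewrite qE q0 horner0.
Qed.

(** The principle behind all genericity arguments: two polynomial conditions on
    a curve, each satisfied at some parameter, hold at a common parameter. *)
Lemma polyfun_common g h a b : polyfun g -> polyfun h -> g a != 0 -> h b != 0 ->
  exists2 t, g t != 0 & h t != 0.
Proof.
move=> /polyfun_neq0 pg /polyfun_neq0 ph /pg[p p0 pE] /ph[q q0 qE].
have [t] := @poly_nonroot (p * q) (mulf_neq0 p0 q0).
by rewrite hornerM mulf_eq0 negb_or -pE -qE => /andP[]; exists t.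
Qed.

Variable n : nat.

Definition polymx (J : R -> 'M[R]_n) := forall i j, polyfun (fun t => J t i j).

Lemma polyfun_det J : polymx J -> polyfun (fun t => \det (J t)).
Proof.
move=> H; apply: polyfun_sum => s; apply: polyfunM; first exact: polyfun_cst.
by apply: polyfun_prod => i; apply: H.
Qed.

Lemma polymx_rowsel T J : polymx J -> polymx (fun t => rowsel T (J t)).
Proof.
move=> H i j; have [iT|iT] := boolP (i \in T).
  by apply: polyfun_ext (H i j) => t; rewrite mxE iT.
by apply: polyfun_ext (polyfun_cst (i == j)%:R) => t; rewrite mxE (negPf iT).
Qed.

Lemma polymx_setrow a b J : polymx J -> polymx (fun t => setrow a b (J t)).
Proof.
move=> H i j; have [ia|ia] := boolP (i == a).
  by apply: polyfun_ext (polyfun_cst (j == b)%:R) => t; rewrite mxE ia.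
by apply: polyfun_ext (H i j) => t; rewrite mxE (negPf ia).
Qed.

Lemma polyfun_meval m (p : mpoly.mpoly m R) (v : R -> 'I_m -> R) :
  (forall i, polyfun (fun t => v t i)) -> polyfun (fun t => mpoly.meval (v t) p).
Proof.
move=> H; apply: (@polyfun_ext (fun t => \sum_(k <- mpoly.msupp p)
    mpoly.mcoeff k p * \prod_i v t i ^+ (mpoly.fun_of_multinom k i))).
  by move=> t; rewrite mpoly.mevalE.
apply: polyfun_sum => k; apply: polyfunM; first exact: polyfun_cst.
by apply: polyfun_prod => i; apply: polyfunX.
Qed.

Lemma polyfun_eval_at p (J : R -> 'M[R]_n) c : polymx J -> polyfun c ->
  polyfun (fun t => eval_at p (J t) (c t)).
Proof.
move=> HJ Hc; apply: polyfun_meval => i.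
case: (split_ordP i) => k ->.
  case/mxvec_indexP: k => a b; apply: polyfun_ext (HJ a b) => t.
  by rewrite row_mxEl mxvecE.
by apply: polyfun_ext Hc => t; rewrite row_mxEr mxE.
Qed.

End PolyFun.

Section Genericity.
Variables (R : realType) (n : nat) (G : network n) (A : {set 'I_n}).
Implicit Types (J K M : 'M[R]_n).

Definition pencil J K t : 'M[R]_n := \matrix_(i, j) (J i j + t * (K i j - J i j)).

Lemma polymx_pencil J K : polymx (pencil J K).
Proof.
move=> i j; apply: (@polyfun_ext _ (fun t => J i j + t * (K i j - J i j))).
  by move=> t; rewrite mxE.
apply: polyfunD; first exact: polyfun_cst.
by apply: polyfunM; [apply: polyfun_id|apply: polyfun_cst].
Qed.

Lemma pencil0 J K : pencil J K 0 = J.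
Proof. by apply/matrixP => i j; rewrite mxE mul0r addr0. Qed.

Lemma pencil1 J K : pencil J K 1 = K.
Proof. by apply/matrixP => i j; rewrite mxE mul1r addrC subrK. Qed.

Lemma pencil_supported J K t : supported G J -> supported G K -> supported G (pencil J K t).
Proof. by move=> sJ sK i j ij; rewrite mxE sJ // sK // subrr mulr0 addr0. Qed.

Variable Q : 'M[R]_n -> R -> R.
Hypothesis polyQ : forall (J : R -> 'M[R]_n) c, polymx J -> polyfun c ->
  polyfun (fun t => Q (J t) (c t)).

(** Let [S] be a smallest set of entries of [J0] that can be changed so as to
    make [D] nonzero, say into [J'], and let [(a, b)] be one of them.  By
    minimality [D] vanishes identically when only the other entries of [S]
    vary, in particular on the segment from [J0] to the matrix [J2] that
    differs from [J'] by restoring the entry [(a, b)].  Since [D] is affine in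
    this entry and takes different values at [J'] and [J2], its cofactor is
    nonzero at [J2], hence almost everywhere on the segment. *)
Lemma nearby_smooth_point J0 c0 : supported G J0 -> \det (rowsel A J0) = 0 ->
  Q J0 c0 != 0 -> exists J a b, [/\ supported G J, \det (rowsel A J) = 0, Q J c0 != 0,
    [/\ a \in A, b \in A & coupled G a b] &
    \det (setrow a b (rowsel A J)) != 0].
Proof.
move=> sJ0 D0 Q0.
pose ok (S : {set 'I_n * 'I_n}) J := [/\ supported G J,
  forall e, e \notin S -> J e.1 e.2 = J0 e.1 e.2 & \det (rowsel A J) != 0].
pose P S := `[< exists J, ok S J >].
have exP : exists S, P S.
  exists [set: 'I_n * 'I_n]%SET; apply/asboolP; exists 1%:M; split.
  - move=> i j; rewrite negb_or => /andP[ij _]; by rewrite mxE (negPf ij).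
  - by move=> e; rewrite inE.
  - rewrite (_ : rowsel A 1%:M = 1%:M) ?det1 ?oner_neq0 //.
    by apply/matrixP => i j; rewrite !mxE if_same.
case: (ex_minset exP) => S /minsetP[/asboolP[J' [sJ' agr D']] Smin].
have zero J e : e \in S -> supported G J ->
    (forall e', e' \notin (S :\ e)%SET -> J e'.1 e'.2 = J0 e'.1 e'.2) -> \det (rowsel A J) = 0.
  move=> eS sJ H; apply/eqP/negPn/negP => DJ.
  have PS : P (S :\ e)%SET by apply/asboolP; exists J.
  have := Smin _ PS (subsetDl _ _) => /setP/(_ e).
  by rewrite !inE eqxx eS.
have /finset.set0Pn[[a b] eS] : S != finset.set0.
  apply: contraNneq D' => S0; rewrite -D0; apply/eqP; congr (\det (rowsel A _)).
  by apply/matrixP => i j; have := agr (i, j); rewrite S0 inE; apply.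
pose J2 := \matrix_(i, j) if (i, j) == (a, b) then J0 a b else J' i j.
have sJ2 : supported G J2.
  move=> i j ij; rewrite mxE; case: eqP => [[<- <-]|_]; [exact: sJ0|exact: sJ'].
have agr2 e : e \notin (S :\ (a, b))%SET -> J2 e.1 e.2 = J0 e.1 e.2.
  rewrite !inE negb_and negbK; case: e => i j; rewrite mxE /=; case: eqP => [[-> ->]//|_ /=].
  exact: agr (i, j).
have D2 := zero J2 _ eS sJ2 agr2.
have J2E i j : i != a \/ j != b -> J2 i j = J' i j.
  move=> H; rewrite mxE; case: eqP => // -[ia jb]; move: H.
  by rewrite ia jb !eqxx; case.
(* otherwise J2 = J', where D does not vanish *)
have J2N : J2 a b != J' a b.
  apply: contraNneq D' => E; rewrite -D2; apply/eqP; congr (\det (rowsel A _)).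
  apply/matrixP => i j; have [->|ia] := eqVneq i a; last by rewrite J2E //; left.
  have [->|jb] := eqVneq j b; first by rewrite E.
  by rewrite J2E //; right.
have aA : a \in A.
  apply/negPn/negP => aA; case/eqP: D'; rewrite -D2; congr (\det _).
  apply/matrixP => i j; rewrite !mxE; case: ifP => // iA; case: eqP => // -[ia _].
  by rewrite -ia iA in aA.
have cab : coupled G a b.
  by apply: contraNT J2N => nc; rewrite sJ2 // sJ'.
set Cf := fun J => \det (setrow a b (rowsel A J)).
have C2 : Cf J2 != 0.
  have : \det (rowsel A J') = 1 * \det (rowsel A J2) + (J' a b - J2 a b) * Cf J2.
    apply: (@det_row_linear _ _ _ _ _ a) => [j|i j ia|i j ia].
    - rewrite [rowsel A J' a j]mxE [rowsel A J2 a j]mxE [setrow _ _ _ a j]mxE aA eqxx mul1r.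
      have [->|jb] := eqVneq j b; first by rewrite mulr1 addrC subrK.
      by have -> : J2 a j = J' a j; [apply: J2E; right|rewrite mulr0 addr0].
    - by rewrite [LHS]mxE [RHS]mxE; case: ifP => // _; rewrite J2E //; left.
    - rewrite [LHS]mxE (negPf ia) [LHS]mxE [RHS]mxE; case: ifP => // _.
      by rewrite J2E //; left.
  rewrite D2 mulr0 add0r => E; apply: contraNneq D' => C0.
  by rewrite E C0 mulr0.
have bA : b \in A.
  apply/negPn/negP => bA; case/eqP: C2; apply/(determinant_alternate (i1 := a) (i2 := b)).
    by apply: contraNneq bA => <-.
  move=> j; rewrite [LHS]mxE eqxx [RHS]mxE; case: ifP => // _.
  by rewrite mxE (negPf bA) eq_sym.
have pQ : polyfun (fun t => Q (pencil J0 J2 t) c0).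
  by apply: polyQ; [apply: polymx_pencil|apply: polyfun_cst].
have pC : polyfun (fun t => Cf (pencil J0 J2 t)).
  by apply/polyfun_det/polymx_setrow/polymx_rowsel/polymx_pencil.
have [||t Qt Ct] := polyfun_common (a := 0) (b := 1) pQ pC.
- by rewrite pencil0.
- by rewrite pencil1.
exists (pencil J0 J2 t), a, b; split=> //; first exact: pencil_supported.
apply: (zero _ _ eS); first exact: pencil_supported.
by move=> e eS'; rewrite mxE agr2 // subrr mulr0 addr0.
Qed.

End Genericity.

(** * Hyperbolicity by scaling rows *)

Section ScaleRows.
Variables (F : comNzRingType) (n : nat).

Definition scale_rows (d : 'I_n -> F) (J : 'M[F]_n) : 'M[F]_n :=
  \matrix_(i, j) (d i * J i j).

Lemma det_scale_rows d J : \det (scale_rows d J) = (\prod_i d i) * \det J.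
Proof.
have -> : scale_rows d J = diag_mx (\row_i d i) *m J.
  by apply/matrixP => i j; rewrite mul_diag_mx !mxE.
by rewrite det_mulmx det_diag; congr (_ * _); apply: eq_bigr => i _; rewrite mxE.
Qed.

Definition scale_row (q : 'I_n) (x : F) := scale_rows (fun i => if i == q then x else 1).

Lemma scale_row1 q J : scale_row q 1 J = J.
Proof. by apply/matrixP => i j; rewrite mxE if_same mul1r. Qed.

End ScaleRows.

Section Hyperbolic.
Variables (R : realType) (n : nat).
Implicit Types (M : 'M[R]_n) (T : {set 'I_n}).
Local Notation C := (complex.complex R).
Local Notation toC := (complex.real_complex R).

Lemma hyperbolic_char_poly M : hyperbolic M <->
  forall z : C, root (map_poly toC (char_poly M)) z -> complex.Re z != 0.
Proof.
by split=> H z; have := H z; rewrite eigenvalue_root_char map_char_poly.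
Qed.

(** Nonreal roots of a real polynomial come in conjugate pairs. *)
Lemma horner_real_conj (p : {poly R}) (z : C) :
  (map_poly toC p).[complex.conjc z] = complex.conjc (map_poly toC p).[z].
Proof.
rewrite -horner_map /= -map_poly_comp; congr (_.[_]).
by apply: eq_map_poly => x /=; rewrite oppr0.
Qed.

(** Multiplying the row [q] by [x] turns the characteristic polynomial into
    [x * al + 'X * be], where the roots of [be] are, up to the root 1, the
    eigenvalues for [T]; so [be] has no root on the imaginary axis.  If [z] on
    the axis is a root of the former, then so is its conjugate [- z], and
    eliminating [x] shows that [z] is a root of
    [al(X) * be(-X) + al(-X) * be(X)].  This polynomial does not depend on [x]
    and its value at 0 is [2 * al(0) * be(0) != 0].  So there are finitely many
    such [z], and each of them is a root for a single value of [x]. *)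
Lemma scaling_hyperbolic M T q (w : {poly R}) : q \notin T ->
  hyperbolic (rowsel T M) -> \det (rowsel (q |: T) M) != 0 -> w != 0 ->
  exists x, [/\ x != 0, w.[x] != 0 & hyperbolic (rowsel (q |: T) (scale_row q x M))].
Proof.
move=> qT /hyperbolic_char_poly hT dqT w0.
set N := rowsel (q |: T) M.
pose al := \det (\matrix_(i, j) if i == q then - (N q j)%:P else char_poly_mx N i j).
pose be := \det (\matrix_(i, j) if i == q then (j == q)%:R else char_poly_mx N i j).
have cpx x : char_poly (rowsel (q |: T) (scale_row q x M)) = x%:P * al + 'X * be.
  apply: (@det_row_linear _ _ _ _ _ q) => [j|i j iq|i j iq]; last first.
  - by rewrite !mxE (negPf iq) mul1r.
  - by rewrite !mxE (negPf iq) mul1r.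
  rewrite !mxE eqxx setU11 eq_sym polyCM; case: eqP => _; rewrite ?mulr1n ?mulr0n; ring.
have cpT : char_poly (rowsel T M) = ('X - 1) * be + 0 * be.
  apply: (@det_row_linear _ _ _ _ _ q) => [j|i j iq|i j iq]; last first.
  - by rewrite !mxE (negPf iq) in_setU1 (negPf iq).
  - by rewrite !mxE (negPf iq) in_setU1 (negPf iq).
  rewrite !mxE eqxx (negPf qT) eq_sym; case: eqP => _; rewrite ?mulr1n ?mulr0n ?polyC0 ?polyC1; ring.
rewrite mul0r addr0 in cpT.
pose a := map_poly toC al; pose b := map_poly toC be.
have b0 z : complex.Re z = 0 -> b.[z] != 0.
  move=> z0; apply/negP => /eqP bz; have := hT z; rewrite z0 eqxx => Hz.
  suff : false by []; apply: Hz.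
  by rewrite rootE cpT rmorphM hornerM -/b bz mulr0.
have al0 : al.[0] != 0.
  have cpN : char_poly N = 1%:P * al + 'X * be by rewrite -cpx scale_row1.
  have := char_poly_det N; rewrite cpN coefD coefCM mul1r coefXM addr0.
  rewrite -horner_coef0 => ->.
  by rewrite mulf_eq0 signr_eq0.
have a0 : a.[0] != 0.
  rewrite /a -[0 in X in X != _](rmorph0 toC) horner_map.
  by rewrite (fmorph_eq0 toC).
pose H := a * (b \Po - 'X) + (a \Po - 'X) * b.
have HE z : H.[z] = a.[z] * b.[- z] + a.[- z] * b.[z].
  by rewrite /H hornerD !hornerM !horner_comp !hornerN !hornerX.
have H0 : H != 0.
  apply/negP => /eqP H0; have := HE 0; rewrite H0 horner0 oppr0.
  move/esym/eqP; rewrite -mulr2n mulrn_eq0 /= mulf_eq0 (negPf a0) (negPf (b0 0 _)) //.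
have [rs rsE] := closed_field_poly_normal H.
pose bad z := complex.Re (- z * b.[z] / a.[z]).
(* The factors exclude the zeros of w, the value 0, and the bad values. *)
pose W := w * 'X * \prod_(z <- rs) ('X - (bad z)%:P).
have W0 : W != 0.
  by rewrite !mulf_neq0 ?polyX_eq0 // monic_neq0 // monic_prod_XsubC.
have [x] := poly_nonroot W0.
rewrite !hornerM hornerX !mulf_eq0 !negb_or -andbA => /and3P[wx x0 px].
exists x; split=> //; apply/hyperbolic_char_poly => z rz; apply/negP => /eqP z0.
(* z is on the imaginary axis *)
have conjz : complex.conjc z = - z.
  by case: z z0 {rz} => u v /= ->; rewrite -[RHS]/(complex.Complex (- 0) (- v)) oppr0.
have E1 : toC x * a.[z] + z * b.[z] = 0.
  move: rz; rewrite rootE cpx rmorphD !rmorphM /= map_polyC map_polyX.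
  by rewrite hornerD !hornerM hornerC hornerX => /eqP.
have E2 : toC x * a.[- z] - z * b.[- z] = 0.
  transitivity (complex.conjc (toC x * a.[z] + z * b.[z])).
    rewrite rmorphD !rmorphM -mulNr; congr (_ * _ + _ * _).
    - by rewrite -[RHS]/(complex.conjc (toC x)) complex.conjc_real.
    - by rewrite -conjz horner_real_conj.
    - by rewrite -conjz.
    - by rewrite -conjz horner_real_conj.
  by rewrite E1 complex.conjc0.
have Hz : H.[z] = 0.
  have x0' : toC x != 0 by rewrite fmorph_eq0.
  apply: (mulfI x0'); rewrite mulr0 HE.
  transitivity (b.[- z] * (toC x * a.[z] + z * b.[z]) + b.[z] * (toC x * a.[- z] - z * b.[- z])).
    by ring.
  by rewrite E1 E2 !mulr0 addr0.
have az : a.[z] != 0.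
  apply/negP => /eqP az; move: E1; rewrite az mulr0 add0r => /eqP.
  rewrite mulf_eq0 (negPf (b0 _ z0)) orbF => /eqP zz.
  by have := a0; rewrite -[X in a.[X]]zz az eqxx.
have xz : toC x = - z * b.[z] / a.[z].
  apply: (mulIf az); rewrite mulfVK //; apply/eqP; rewrite -subr_eq0 mulNr opprK.
  exact/eqP.
have zrs : z \in rs.
  have : root H z by rewrite rootE Hz.
  by rewrite rsE rootZ ?lead_coef_eq0 // root_prod_XsubC.
have xbad : x = bad z by rewrite /bad -xz.
have : root (\prod_(c <- map bad rs) ('X - c%:P)) x.
  by rewrite root_prod_XsubC xbad map_f.
by rewrite rootE big_map (negPf px).
Qed.

End Hyperbolic.

(** * Generic points of the locus *)

Section GenericPoint.
Variables (R : realType) (n : nat) (G : network n) (A : {set 'I_n}).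
Implicit Types (J K M : 'M[R]_n) (T : {set 'I_n}).

Lemma rowsel_scale_rows T (d : 'I_n -> R) J :
  rowsel T (scale_rows d J) = scale_rows (fun i => if i \in T then d i else 1) (rowsel T J).
Proof.
by apply/matrixP => i j; rewrite !mxE; case: ifP => _; rewrite ?mxE ?mul1r.
Qed.

Lemma setrow_scale_rows a b (d : 'I_n -> R) J :
  setrow a b (scale_rows d J) = scale_rows (fun i => if i == a then 1 else d i) (setrow a b J).
Proof.
by apply/matrixP => i j; rewrite !mxE; case: ifP => _; rewrite ?mxE ?mul1r.
Qed.

Lemma supported_scale_rows (d : 'I_n -> R) J : supported G J -> supported G (scale_rows d J).
Proof. by move=> sJ i j ij; rewrite mxE sJ // mulr0. Qed.

Lemma det_rowsel_scale_rows T (d : 'I_n -> R) J :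
  \det (rowsel T J) = 0 -> \det (rowsel T (scale_rows d J)) = 0.
Proof. by move=> D0; rewrite rowsel_scale_rows det_scale_rows D0 mulr0. Qed.

Variables (Q : 'M[R]_n -> R -> R) (g : 'M[R]_n -> R).
Hypothesis polyQ : forall (J : R -> 'M[R]_n) c, polymx J -> polyfun c ->
  polyfun (fun t => Q (J t) (c t)).
Hypothesis polyg : forall J : R -> 'M[R]_n, polymx J -> polyfun (fun t => g (J t)).
Hypothesis scaleg : forall (d : 'I_n -> R) J, (forall i, d i != 0) -> g J != 0 ->
  g (scale_rows d J) != 0.

(** By [nearby_smooth_point] the point [J0] may be assumed to have a nonzero
    cofactor of [D] at some entry [(a, b)]; the matrix [K] has one at every
    entry.  On the segment from [J0] to [K], the equation [D = 0] is restored
    by adjusting the entry [(a, b)], at the cost of dividing by this cofactor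
    [C t].  Multiplying the row [a] by [C t / C 0] instead keeps the curve
    polynomial; it starts at [J0] and ends at [K] with the row [a] scaled,
    which does not affect the condition [g != 0]. *)
Lemma locus_irreducible J0 c0 K :
  supported G J0 -> \det (rowsel A J0) = 0 -> Q J0 c0 != 0 ->
  supported G K -> \det (rowsel A K) = 0 -> g K != 0 ->
  (forall a b, a \in A -> b \in A -> \det (setrow a b (rowsel A K)) != 0) ->
  exists J c, [/\ supported G J, \det (rowsel A J) = 0, Q J c != 0, g J != 0 & c != 0].
Proof.
move=> sJ0 D0 Q0 sK DK gK CK.
have [J1 [a [b [sJ1 D1 Q1 [aA bA cab] C1]]]] := nearby_smooth_point polyQ sJ0 D0 Q0.
have {}CK := CK a b aA bA.
pose P t := pencil J1 K t.
pose D t := \det (rowsel A (P t)).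
pose C t := \det (setrow a b (rowsel A (P t))).
have pP : polymx P by apply: polymx_pencil.
have pD : polyfun D by apply/polyfun_det/polymx_rowsel.
have pC : polyfun C by apply/polyfun_det/polymx_setrow/polymx_rowsel.
have C00 : C 0 != 0 by rewrite /C /P pencil0.
have C10 : C 1 != 0 by rewrite /C /P pencil1.
pose J t : 'M[R]_n := \matrix_(i, j)
  if i == a then (C 0)^-1 * (C t * P t a j + - D t * (j == b)%:R) else P t i j.
have pJ : polymx J.
  move=> i j; have [->|ia] := eqVneq i a.
    apply: (@polyfun_ext _ (fun t => (C 0)^-1 * (C t * P t a j + - D t * (j == b)%:R))).
      by move=> t; rewrite [RHS]mxE eqxx.
    apply: polyfunM; first exact: polyfun_cst.
    apply: polyfunD; first exact: polyfunM.
    by apply: polyfunM; [apply: polyfunN|apply: polyfun_cst].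
  by apply: polyfun_ext (pP i j) => t; rewrite [RHS]mxE (negPf ia).
have sJ t : supported G (J t).
  move=> i j ij; rewrite mxE; have sP := pencil_supported t sJ1 sK.
  case: eqP => [ia|_]; last exact: sP.
  rewrite ia in ij; rewrite /P sP // mulr0 add0r; case: eqP => [jb|_]; last by rewrite !mulr0.
  by rewrite jb cab in ij.
have DJ t : \det (rowsel A (J t)) = 0.
  rewrite (@det_row_linear _ _ _ (rowsel A (P t)) (setrow a b (rowsel A (P t))) a
    (C t / C 0) (- D t / C 0)) => [|j|i j ia|i j ia].
  - by rewrite -/(D t) -/(C t); ring.
  - rewrite [LHS]mxE aA [J t a j]mxE eqxx [setrow _ _ _ a j]mxE eqxx [rowsel _ _ a j]mxE aA.
    by ring.
  - by rewrite [LHS]mxE [RHS]mxE [J t i j]mxE (negPf ia).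
  - by rewrite [LHS]mxE (negPf ia) [LHS]mxE [RHS]mxE [J t i j]mxE (negPf ia).
have J0E : J 0 = J1.
  apply/matrixP => i j; rewrite mxE /D /P !pencil0 D1 oppr0 mul0r addr0.
  by rewrite mulKf //; case: eqP => [->|].
have J1E : J 1 = scale_rows (fun i => if i == a then C 1 / C 0 else 1) K.
  apply/matrixP => i j; rewrite [LHS]mxE [RHS]mxE {1}/D /P !pencil1 DK oppr0 mul0r addr0.
  by case: eqP => [->|_]; rewrite ?mul1r // mulrA [_^-1 * _]mulrC.
pose c t := c0 + t * (1 - c0).
have pc : polyfun c.
  apply: polyfunD; first exact: polyfun_cst.
  by apply: polyfunM; [apply: polyfun_id|apply: polyfun_cst].
have [||t Qt] := polyfun_common (a := 0) (b := 1) (polyQ pJ pc) (polyfunM (polyg pJ) pc).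
- by rewrite J0E /c mul0r addr0.
- rewrite J1E /c mul1r addrC subrK mulr1; apply: scaleg => // i.
  case: (i == a); last exact: oner_neq0.
  by apply: mulf_neq0 => //; apply: invr_neq0.
rewrite mulf_eq0 negb_or => /andP[gt ct].
by exists (J t), (c t).
Qed.

Variable p0 : 'I_n.
Hypothesis minors : forall J T, g J != 0 -> p0 \notin T \/ T = [set: 'I_n]%SET ->
  \det (rowsel T J) != 0.

Lemma hyperbolic_step J c T q : q \notin T ->
  (p0 \notin T /\ q != p0) \/ (q |: T = [set: 'I_n])%SET ->
  [/\ supported G J, \det (rowsel A J) = 0, Q J c != 0, g J != 0 &
     hyperbolic (rowsel T J)] ->
  exists J', [/\ supported G J', \det (rowsel A J') = 0, Q J' c != 0, g J' != 0 &
     hyperbolic (rowsel (q |: T) J')].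
Proof.
move=> qT Tq [sJ DJ QJ gJ hJ].
have dT : \det (rowsel (q |: T) J) != 0.
  apply: minors => //; case: Tq => [[pT qp]|]; [left|by right].
  by rewrite !inE negb_or eq_sym qp.
have pS : polymx (fun x => scale_row q x J).
  move=> i j; apply: (@polyfun_ext _ (fun x => (if i == q then x else 1) * J i j)).
    by move=> x; rewrite mxE.
  apply: polyfunM; last exact: polyfun_cst.
  by case: eqP => _; [apply: polyfun_id|apply: polyfun_cst].
have Q1 : Q (scale_row q 1 J) c != 0 by rewrite scale_row1.
have [w w0 wE] := polyfun_neq0 (a := 1) (polyQ pS (polyfun_cst c)) Q1.
have [x [x0 wx hx]] := scaling_hyperbolic qT hJ dT w0.
exists (scale_row q x J); split=> //.
- exact: supported_scale_rows.
- exact: det_rowsel_scale_rows.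
- by rewrite wE.
- by apply: scaleg => // i; case: (i == q) => //; apply: oner_neq0.
Qed.

(** Rows are scaled one at a time, so that each step has a nonzero principal
    minor to use.  The row [p0] comes last because [minors] only controls the
    principal minors without [p0] and the full determinant: for [p0] in [A]
    the minor of [A] itself vanishes. *)
Lemma generic_hyperbolic J c :
  [/\ supported G J, \det (rowsel A J) = 0, Q J c != 0 & g J != 0] ->
  exists J', [/\ supported G J', \det (rowsel A J') = 0, Q J' c != 0, g J' != 0 &
     hyperbolic J'].
Proof.
move=> [sJ DJ QJ gJ].
have H k : forall T, p0 \notin T -> #|T| = k ->
    exists J', [/\ supported G J', \det (rowsel A J') = 0, Q J' c != 0, g J' != 0 &
     hyperbolic (rowsel T J')].
  elim: k => [|k IH] T pT cT.
    exists J; split=> //; have -> : rowsel T J = 1%:M.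
      have T0 := card0_eq cT; apply/matrixP => i j; rewrite !mxE.
      by have := T0 i; rewrite !inE => ->.
    move=> z; rewrite map_mx1 => /eigenvalueP[v].
    rewrite mulmx1 => /eqP; rewrite -subr_eq0 -{1}[v]scale1r -scalerBl scaler_eq0.
    move=> /orP[|/eqP->]; last by rewrite eqxx.
    by rewrite subr_eq0 => /eqP <- _; rewrite /= oner_neq0.
  have [q qT] : exists q, q \in T by apply/card_gt0P; rewrite cT.
  have [||J' HJ'] := IH (T :\ q)%SET.
  - by rewrite !inE negb_and pT orbT.
  - by have := cardsD1 q T; rewrite qT cT => -[->].
  have qTq : q \notin (T :\ q)%SET by rewrite !inE eqxx.
  have := hyperbolic_step qTq _ HJ'; rewrite finset.setD1K //; apply; left; split.
    by rewrite !inE negb_and pT orbT.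
  by apply: contraNneq pT => <-.
have p0N : p0 \notin (~: [set p0])%SET by rewrite !inE eqxx.
have pE : (p0 |: ~: [set p0] = [set: 'I_n])%SET.
  by apply/setP => i; rewrite !inE orbN.
have [J' HJ'] := H #|(~: [set p0])%SET| (~: [set p0])%SET p0N (erefl _).
have [J2 [s2 D2 Q2 g2 h2]] := hyperbolic_step p0N (or_intror pE) HJ'.
have E : J2 = rowsel (p0 |: ~: [set p0])%SET J2.
  by apply/matrixP => i j; rewrite mxE !inE orbN.
exists J2; split; [exact: s2|exact: D2|exact: Q2|exact: g2|].
rewrite E; exact: h2.
Qed.

End GenericPoint.

(** * Matrices witnessing the generic conditions *)

Section Laplacian.
Variables (R : realType) (n : nat) (G : network n) (A : {set 'I_n}).
Hypothesis scA : forall a b, a \in A -> b \in A -> connect (restrict G A) a b.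
Implicit Types (w : 'I_n -> R) (a b i j l : 'I_n).

Definition lap_at w i := \sum_(l in A) (arrow G l i)%:R * (w i - w l).

(** The Laplacian of the subnetwork [A] is a point of the hypersurface [D = 0]
    at which all cofactors of [D] are nonzero. *)
Definition laplacian : 'M[R]_n :=
  \matrix_(i, j) \sum_(l in A) (arrow G l i)%:R * ((i == j)%:R - (l == j)%:R).

Lemma laplacian_row w i : \sum_j laplacian i j * w j = lap_at w i.
Proof.
under eq_bigr => j _ do rewrite mxE mulr_suml.
rewrite exchange_big /=; apply: eq_bigr => l _.
under eq_bigr => j _ do rewrite -mulrA mulrBl.
by rewrite -mulr_sumr sumrB !sum_delta.
Qed.

Lemma laplacian_offdiag i j : i != j -> laplacian i j = - ((j \in A) && arrow G j i)%:R.
Proof.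
move=> ij; rewrite mxE; have [jA|jA] /= := boolP (j \in A).
  rewrite (bigD1 j) //= (negPf ij) eqxx sub0r mulrN1 big1 ?addr0 // => l /andP[_ lj].
  by rewrite (negPf lj) subrr mulr0.
rewrite oppr0 big1 // => l lA; rewrite (negPf ij) (_ : l == j = false) ?subrr ?mulr0 //.
by apply/negbTE; apply: contraNneq jA => <-.
Qed.

(** The maximum principle: if a positive maximum of [w] is attained at [v] then
    it is attained at all nodes with an arrow to [v], hence at [p] by strong
    connectivity. *)
Lemma lap_le0 p w : p \in A -> w p = 0 ->
  (forall i, i \in A -> w i = 0 \/ lap_at w i = 0) -> forall i, i \in A -> w i <= 0.
Proof.
move=> pA wp H; case: (@arg_maxP _ _ _ p (mem A) w pA) => m mA mmax.
suff wm : w m <= 0 by move=> i iA; apply: le_trans (mmax i iA) wm.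
rewrite leNgt; apply/negP => wm0.
have Pp : [pred x | w x != w m] p by rewrite /= wp eq_sym gt_eqF.
have Pm : ~~ [pred x | w x != w m] m by rewrite /= eqxx.
have [u [v [/= Pu Pv /and3P[uA vA uv] _ _]]] := connect_exit (scA pA mA) Pp Pm.
move: Pv; rewrite negbK => /eqP wv; case/eqP: Pu.
have [E|] := H v vA; first by rewrite -wv E ltxx in wm0.
move/eqP; rewrite psumr_eq0 => [/allP/(_ u)|l lA]; last first.
  by rewrite mulr_ge0 ?ler0n // subr_ge0 wv; apply: mmax.
by rewrite mem_index_enum uA uv mul1r subr_eq0 wv => /(_ isT)/eqP.
Qed.

Lemma lap_eq0 p w : p \in A -> w p = 0 ->
  (forall i, i \in A -> w i = 0 \/ lap_at w i = 0) -> forall i, i \in A -> w i = 0.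
Proof.
move=> pA wp H i iA; apply/eqP; rewrite eq_le (lap_le0 pA wp H iA) /=.
rewrite -oppr_le0; apply: (@lap_le0 p (fun i => - w i)) => // [|j jA].
  by rewrite wp oppr0.
have [->|E] := H j jA; [by left; rewrite oppr0|right].
rewrite -[RHS]oppr0 -E -sumrN; apply: eq_bigr => l _.
by rewrite -mulrN opprD opprK addrC.
Qed.

Lemma lap_const p w : p \in A ->
  (forall i, i \in A -> i != p -> lap_at w i = 0) -> forall i, i \in A -> w i = w p.
Proof.
move=> pA H i iA; apply/eqP; rewrite -subr_eq0; apply/eqP.
apply: (@lap_eq0 p (fun i => w i - w p)) => // [|j jA]; first by rewrite subrr.
have [->|jp] := eqVneq j p; [by left; rewrite subrr|right].
rewrite -[RHS](H j jA jp); apply: eq_bigr => l _; congr (_ * _).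
by rewrite opprB addrA subrK.
Qed.

Section LikeLaplacian.
Variable K : 'M[R]_n.
Hypothesis KL : forall i j, i \in A -> j \in A -> K i j = laplacian i j.

Lemma like_laplacian_row w i : (forall j, j \notin A -> w j = 0) -> i \in A ->
  \sum_j K i j * w j = lap_at w i.
Proof.
move=> wA iA; rewrite -laplacian_row; apply: eq_bigr => j _.
by have [jA|/wA->] := boolP (j \in A); [rewrite KL|rewrite !mulr0].
Qed.

(** Constant vectors are in the kernel. *)
Lemma like_laplacian_det : (exists a, a \in A) -> \det (rowsel A K) = 0.
Proof.
move=> [a aA]; apply/det0_kernel; exists (fun i => (i \in A)%:R); split.
  by exists a; rewrite aA oner_neq0.
move=> i; rewrite rowsel_row; case: ifP => iA; last by rewrite iA.
rewrite like_laplacian_row //; last by move=> j /negPf->.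
by apply: big1 => l lA; rewrite iA lA subrr mulr0.
Qed.

(** A vector on which the Laplacian vanishes outside [a] is constant by the
    maximum principle, and the extra equation says that it vanishes at [b]. *)
Lemma like_laplacian_cofactor a b : a \in A -> b \in A ->
  \det (setrow a b (rowsel A K)) != 0.
Proof.
move=> aA bA; apply: det_neq0_kernel => w Hw.
have wb : w b = 0 by have := Hw a; rewrite setrow_row eqxx.
have wA j : j \notin A -> w j = 0.
  move=> jA; have := Hw j; rewrite setrow_row rowsel_row (negPf jA).
  by case: eqP => // ja; rewrite ja aA in jA.
have wc : forall i, i \in A -> w i = w a.
  apply: lap_const => // i iA ia; have := Hw i.
  by rewrite setrow_row rowsel_row (negPf ia) iA like_laplacian_row.
by move=> i; have [/wc->|/wA//] := boolP (i \in A); rewrite -(wc b bA).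
Qed.

End LikeLaplacian.

(** A point of the hypersurface at which all the arrows have a nonzero
    coefficient. *)
Definition arrows_witness : 'M[R]_n := \matrix_(i, j)
  if (i \in A) && (j \in A) then laplacian i j else (coupled G i j)%:R.

Lemma arrows_witness_supported : supported G arrows_witness.
Proof.
move=> i j ij; rewrite mxE (negPf ij); case: ifP => // _.
move: ij; rewrite negb_or => /andP[ij /negPf ji].
by rewrite laplacian_offdiag // ji andbF oppr0.
Qed.

Lemma arrows_witness_like i j : i \in A -> j \in A -> arrows_witness i j = laplacian i j.
Proof. by move=> iA jA; rewrite mxE iA jA. Qed.

Lemma arrows_witness_neq0 i j : i != j -> arrow G j i -> arrows_witness i j != 0.
Proof.
move=> ij ji; rewrite mxE; case: ifP => [/andP[_ jA]|_].
  by rewrite laplacian_offdiag // jA ji oppr_eq0 oner_neq0.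
by rewrite /coupled ji orbT oner_neq0.
Qed.

End Laplacian.

Section ChainWitness.
Variables (R : realType) (n : nat) (G : network n) (A : {set 'I_n}).
Hypothesis scA : forall a b, a \in A -> b \in A -> connect (restrict G A) a b.
Implicit Types (w : 'I_n -> R).

Variables (k : 'I_n) (p : seq 'I_n) (q0 : 'I_n) (g : seq 'I_n) (p0 : 'I_n).
Hypotheses (pathp : path (arrow G) (inp G) p) (lastp : last (inp G) p = k)
  (uniqp : uniq (inp G :: p)) (pA : forall x, x \in inp G :: p -> x \notin A).
Hypotheses (q0A : q0 \in A) (p0A : p0 \in A) (pathg : path (arrow G) q0 g)
  (uniqg : uniq g) (arrg : arrow G (last q0 g) p0) (lastg : last q0 g \in g)
  (gA : forall x, x \in g -> x \notin A) (gp : forall x, x \in g -> x \notin inp G :: p).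

(** The node that precedes [y] on the path [x :: s]. *)
Definition pred_in (x : 'I_n) (s : seq 'I_n) y := nth x (x :: s) (index y s).

Lemma pred_in_path (e : rel 'I_n) x s y : path e x s -> y \in s -> e (pred_in x s y) y.
Proof.
move=> /(pathP x) H ys; have := H (index y s); rewrite index_mem ys nth_index //.
exact.
Qed.

Lemma path_pred_in (e : rel 'I_n) x s : uniq s ->
  (forall y, y \in s -> e (pred_in x s y) y) -> path e x s.
Proof.
move=> us H; apply/(pathP x) => i lt; have := H (nth x s i) (mem_nth _ lt).
by rewrite /pred_in index_uniq.
Qed.

(** The equations of this matrix say: the value at a node of the path [p] or of
    the excursion [g] equals the value at the preceding node, the values in [A]
    are harmonic, up to a perturbation at [p0] by the value at the end of the
    excursion, and the other values are zero. *)
Definition chain_witness : 'M[R]_n := \matrix_(i, j)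
  if i \in A then laplacian R G A i j + ((i == p0) && (j == last q0 g))%:R
  else (i == j)%:R - (i \in p)%:R * (pred_in (inp G) p i == j)%:R
                   - (i \in g)%:R * (pred_in q0 g i == j)%:R.

Lemma chain_witness_row w i : \sum_j chain_witness i j * w j =
  if i \in A then lap_at G A w i + (i == p0)%:R * w (last q0 g)
  else w i - (i \in p)%:R * w (pred_in (inp G) p i) - (i \in g)%:R * w (pred_in q0 g i).
Proof.
case: ifP => iA.
  rewrite -laplacian_row -[in RHS](sum_delta' (last q0 g) w) mulr_sumr -big_split /=.
  by apply: eq_bigr => j _; rewrite mxE iA mulrDl mulrA -natrM mulnb.
rewrite -[in RHS](sum_delta i w) -[in X in _ - X - _](sum_delta (pred_in (inp G) p i) w).
rewrite -[in X in _ - X](sum_delta (pred_in q0 g i) w) !mulr_sumr -!sumrB.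
by apply: eq_bigr => j _; rewrite mxE iA !mulrBl !mulrA.
Qed.

Lemma chain_witness_supported : supported G chain_witness.
Proof.
move=> i j; rewrite negb_or => /andP[ij ji]; rewrite mxE (negPf ij).
case: ifP => iA.
  rewrite laplacian_offdiag // (negPf ji) andbF oppr0 add0r.
  case: eqP => //= ip; case: eqP => //= jl; by rewrite ip jl arrg in ji.
have E s x : path (arrow G) x s -> (i \in s)%:R * (pred_in x s i == j)%:R = 0 :> R.
  move=> ps; have [is_|] := boolP (i \in s); last by rewrite mul0r.
  case: eqP => [E|_]; last by rewrite mulr0.
  by have := pred_in_path ps is_; rewrite E (negPf ji).
by rewrite !E // !subr0.
Qed.

Lemma chain_witness_like i j : i \in A -> j \in A -> chain_witness i j = laplacian R G A i j.
Proof.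
move=> iA jA; rewrite mxE iA (_ : j == _ = false) ?andbF ?addr0 //.
by apply/negbTE; apply: contraTneq jA => ->; apply: gA.
Qed.

Lemma chain_eq0 w x s : path (fun a b => (w b == w a) || (w b == 0)) x s -> w x = 0 ->
  forall y, y \in s -> w y = 0.
Proof.
elim: s x => //= z s IH x /andP[+ ps] wx y; rewrite wx orbb => /eqP wz.
by rewrite inE => /orP[/eqP->//|]; apply: (IH z).
Qed.

Lemma chain_const w x s : path (fun a b => w b == w a) x s -> w (last x s) = w x.
Proof. by elim: s x => //= z s IH x /andP[/eqP zx /IH ->]. Qed.

Lemma chain_witness_row_path w i : i \in p -> \sum_j chain_witness i j * w j = w i - w (pred_in (inp G) p i).
Proof.
move=> ip; have iP : i \in inp G :: p by rewrite inE ip orbT.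
rewrite chain_witness_row (negPf (pA iP)) ip (_ : i \in g = false) ?mul0r ?mul1r ?subr0 //.
by apply/negbTE; apply: contraTN iP => /gp.
Qed.

Lemma chain_witness_row_excursion w i : i \in g -> \sum_j chain_witness i j * w j = w i - w (pred_in q0 g i).
Proof.
move=> ig; rewrite chain_witness_row (negPf (gA ig)) ig (_ : i \in p = false) ?mul0r ?mul1r ?subr0 //.
by apply/negbTE; have := gp ig; rewrite inE negb_or => /andP[].
Qed.

Lemma chain_witness_row_other w i : i \notin A -> i \notin p -> i \notin g ->
  \sum_j chain_witness i j * w j = w i.
Proof.
by move=> iA ip ig; rewrite chain_witness_row (negPf iA) (negPf ip) (negPf ig) !mul0r !subr0.
Qed.

Lemma inp_off_chain : [/\ inp G \notin A, inp G \notin p & inp G \notin g].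
Proof.
split; first by apply: pA; rewrite mem_head.
  by case/andP: uniqp.
by apply/negP => /gp; rewrite mem_head.
Qed.

(** Without the equation at [p0], the value at [p0] is zero, and the maximum
    principle makes all values in [A] zero. *)
Lemma chain_witness_minor (T : {set 'I_n}) : p0 \notin T -> \det (rowsel T chain_witness) != 0.
Proof.
move=> pT; apply: det_neq0_kernel => w Hw.
have wT i : i \notin T -> w i = 0 by move=> iT; have := Hw i; rewrite rowsel_row (negPf iT).
have wJ i : w i = 0 \/ \sum_j chain_witness i j * w j = 0.
  by have [iT|/wT] := boolP (i \in T); [right; have := Hw i; rewrite rowsel_row iT|left].
have wA : forall i, i \in A -> w i = 0.
  apply: (lap_eq0 scA p0A (wT _ pT)) => i iA; have [E|E] := wJ i; [by left|].
  have [ip|ip] := eqVneq i p0; first by left; rewrite ip wT.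
  by right; move: E; rewrite chain_witness_row iA (negPf ip) mul0r addr0.
have [iA ip ig] := inp_off_chain.
have wi : w (inp G) = 0 by have [//|] := wJ (inp G); rewrite chain_witness_row_other.
have wp : forall y, y \in p -> w y = 0.
  apply: (chain_eq0 _ wi); apply: path_pred_in => [|y yp]; first by case/andP: uniqp.
  have [->|] := wJ y; first by rewrite eqxx orbT.
  by rewrite chain_witness_row_path // => /eqP; rewrite subr_eq0 => ->.
have wg : forall y, y \in g -> w y = 0.
  apply: (chain_eq0 _ (wA _ q0A)); apply: path_pred_in => // y yg.
  have [->|] := wJ y; first by rewrite eqxx orbT.
  by rewrite chain_witness_row_excursion // => /eqP; rewrite subr_eq0 => ->.
move=> i; have [/wA//|nA] := boolP (i \in A); have [/wp//|np] := boolP (i \in p).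
have [/wg//|ng] := boolP (i \in g).
by have [//|] := wJ i; rewrite chain_witness_row_other.
Qed.

(** The values in [A] are constant by the maximum principle, and the excursion
    carries this constant [t] from [q0] to the equation at [p0].  The Laplacian
    vanishes on constants, so this equation reduces to [t = 0]. *)
Lemma chain_witness_kernel w : w (inp G) = 0 ->
  (forall i, i != inp G -> \sum_j chain_witness i j * w j = 0) -> forall i, w i = 0.
Proof.
move=> wi Hw; have [iA ip ig] := inp_off_chain.
have ne (s : seq 'I_n) i : inp G \notin s -> i \in s -> i != inp G.
  by move=> h is_; apply: contraNneq h => <-.
have wp : forall y, y \in p -> w y = 0.
  apply: (chain_eq0 _ wi); apply: path_pred_in => [|y yp]; first by case/andP: uniqp.
  have := Hw y (ne p y ip yp); rewrite chain_witness_row_path // => /eqP.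
  by rewrite subr_eq0 => ->.
have pg : path (fun a b => w b == w a) q0 g.
  apply: path_pred_in => // y yg.
  have := Hw y (ne g y ig yg); rewrite chain_witness_row_excursion // => /eqP.
  by rewrite subr_eq0.
have wl : w (last q0 g) = w q0 by apply: chain_const.
have iA' i : i \in A -> i != inp G by move=> iiA; apply: contraNneq iA => <-.
have wc : forall i, i \in A -> w i = w p0.
  apply: (lap_const scA) => // i iiA ip0; have := Hw i (iA' i iiA).
  by rewrite chain_witness_row iiA (negPf ip0) mul0r addr0.
have wp0 : w p0 = 0.
  have := Hw p0 (iA' p0 p0A); rewrite chain_witness_row p0A eqxx mul1r wl (wc _ q0A).
  rewrite /lap_at big1 ?add0r // => l lA; by rewrite (wc l lA) subrr mulr0.
have wA i : i \in A -> w i = 0 by move=> /wc ->.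
have wg : forall y, y \in g -> w y = 0.
  apply: (chain_eq0 _ (wA _ q0A)); apply: sub_path pg => a b ->; exact: orTb.
move=> i; have [/wA//|nA] := boolP (i \in A); have [/wp//|np] := boolP (i \in p).
have [/wg//|ng] := boolP (i \in g).
have [->//|ii] := eqVneq i (inp G).
by have := Hw i ii; rewrite chain_witness_row_other.
Qed.

Lemma chain_witness_det : \det chain_witness != 0.
Proof.
apply: det_neq0_kernel => w Hw; apply: chain_witness_kernel => [|i _]; last exact: Hw.
by have [iA ip ig] := inp_off_chain; have := Hw (inp G); rewrite chain_witness_row_other.
Qed.

Lemma chain_witness_setrow : \det (setrow (inp G) k chain_witness) != 0.
Proof.
apply: det_neq0_kernel => w Hw.
have Hw' i : i != inp G -> \sum_j chain_witness i j * w j = 0.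
  by move=> ii; have := Hw i; rewrite setrow_row (negPf ii).
apply: chain_witness_kernel => //.
have wk : w k = 0 by have := Hw (inp G); rewrite setrow_row eqxx.
rewrite -wk -lastp; symmetry; apply: chain_const.
have [iA ip ig] := inp_off_chain.
apply: path_pred_in => [|y yp]; first by case/andP: uniqp.
have yi : y != inp G by apply: contraNneq ip => <-.
by have := Hw' y yi; rewrite chain_witness_row_path // => /eqP; rewrite subr_eq0.
Qed.

End ChainWitness.

(** * Nodes not induced by an appendage subnetwork *)

Section NotInduced.
Variables (R : realType) (n : nat) (G : network n) (A : {set 'I_n}).
Hypotheses (cG : core G) (appA : appendage_subnetwork G A).

Definition minors_product (k p0 : 'I_n) (J : 'M[R]_n) :=
  \det (setrow (inp G) k J) *
  \prod_(T : {set 'I_n} | (p0 \notin T) || (T == [set: 'I_n]%SET)) \det (rowsel T J).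

Definition arrows_product (J : 'M[R]_n) :=
  \prod_(e : 'I_n * 'I_n | (e.1 != e.2) && arrow G e.2 e.1) J e.1 e.2.

Lemma polyfun_minors_product k p0 (J : R -> 'M[R]_n) : polymx J ->
  polyfun (fun t => minors_product k p0 (J t)).
Proof.
move=> pJ; apply: polyfunM; first exact/polyfun_det/polymx_setrow.
by apply: polyfun_prod => T; apply/polyfun_det/polymx_rowsel.
Qed.

Lemma polyfun_arrows_product (J : R -> 'M[R]_n) : polymx J ->
  polyfun (fun t => arrows_product (J t)).
Proof. by move=> pJ; apply: polyfun_prod => e; apply: pJ. Qed.

Lemma minors_product_scale k p0 (d : 'I_n -> R) (J : 'M[R]_n) :
  (forall i, d i != 0) -> minors_product k p0 J != 0 ->
  minors_product k p0 (scale_rows d J) != 0.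
Proof.
move=> d0; rewrite !mulf_eq0 !negb_or => /andP[dk /prodf_neq0 dT]; apply/andP; split.
  rewrite setrow_scale_rows det_scale_rows mulf_neq0 //; apply/prodf_neq0 => i _.
  by case: (i == _); rewrite ?oner_neq0.
apply/prodf_neq0 => T HT; rewrite rowsel_scale_rows det_scale_rows mulf_neq0 ?dT //.
by apply/prodf_neq0 => i _; case: (i \in T); rewrite ?oner_neq0.
Qed.

Lemma arrows_product_scale (d : 'I_n -> R) (J : 'M[R]_n) :
  (forall i, d i != 0) -> arrows_product J != 0 -> arrows_product (scale_rows d J) != 0.
Proof.
move=> d0 /prodf_neq0 H; apply/prodf_neq0 => e He.
by rewrite mxE mulf_neq0 ?H.
Qed.

(** Starting from a point where the exceptional polynomial is nonzero, the
    conditions of [chain_witness] and those of [arrows_witness] are added in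
    turn, then hyperbolicity. *)
Lemma not_separates_not_induces r a : super_simple G r -> a \in A ->
  avoids G r a (out G) -> ~ induces R G (full_subnetwork G A) r.
Proof.
move=> ssr aA ao [s [t [lev [eta [hb EK [p [[J0 [c0 [sJ0 D0 Q0]]] ind]]]]]]].
have scA : forall x y, x \in A -> y \in A -> connect (restrict G A) x y.
  exact: (appendage_subnetwork_connect appA).
have ib := subnetwork_is_block_of hb EK (appendage_subnetwork_neq0 appA) scA.
have [q0 [g [p0 [q0A p0A [pg ug ag lg] gA]]]] := excursion appA cG ssr aA ao.
have [/connectP[w0 pw0 lw0] _] := cG r.
case: (shortenP pw0) lw0 => w pw uw _ lw {w0 pw0}.
have ps : simple_path G (inp G) r (inp G :: w) by apply/simple_pathP; exists w.
have wA x : x \in inp G :: w -> x \notin A.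
  move=> xw; apply/negP => xA; apply: (appendage_subnetwork_appendage appA xA).
  have [S [pS sS _]] := extend_to_io_path cG ssr ps.
  by exists S => //; apply: sS.
have gw x : x \in g -> x \notin inp G :: w.
  move=> /gA[_ xo]; apply/negP => xw; apply: (avoids_inp_out ssr _ xo).
  apply: (avoids_before_last ps xw); apply/eqP => xr.
  by case/andP: xo; rewrite xr eqxx.
have gA' x : x \in g -> x \notin A by case/gA.
pose Q1 := @eval_at R n p.
have pQ1 (J : R -> 'M[R]_n) c : polymx J -> polyfun c -> polyfun (fun t => Q1 (J t) (c t)).
  exact: polyfun_eval_at.
pose K1 := chain_witness R G A w q0 g p0.
pose g1 := minors_product r p0.
have K1L : forall i j, i \in A -> j \in A -> K1 i j = laplacian R G A i j.
  by move=> i j; apply: chain_witness_like.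
have gK1 : g1 K1 != 0.
  apply: mulf_neq0; first exact: chain_witness_setrow.
  apply/prodf_neq0 => T /orP[pT|/eqP->]; first exact: chain_witness_minor.
  have -> : rowsel [set: 'I_n]%SET K1 = K1 by apply/matrixP => i j; rewrite mxE finset.in_setT.
  exact: chain_witness_det.
have DJ0 : \det (rowsel A J0) = 0 by apply/(is_block_of_det _ ib).
have A0 := appendage_subnetwork_neq0 appA.
have Q0' : Q1 J0 c0 != 0 by apply/eqP.
have [J1 [c1 [sJ1 D1 QJ1 gJ1 c1N]]] := locus_irreducible pQ1
  (@polyfun_minors_product r p0) (@minors_product_scale r p0) sJ0 DJ0
  Q0' (chain_witness_supported R A pw pg ag) (like_laplacian_det K1L A0) gK1
  (like_laplacian_cofactor scA K1L).
(* The conditions obtained so far become part of the condition to be kept. *)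
pose Q2 (J : 'M[R]_n) c := Q1 J c * (g1 J * c).
have pQ2 (J : R -> 'M[R]_n) c : polymx J -> polyfun c -> polyfun (fun t => Q2 (J t) (c t)).
  move=> pJ pc; apply: polyfunM; first exact: pQ1.
  by apply: polyfunM => //; apply: polyfun_minors_product.
have QJ1' : Q2 J1 c1 != 0 by apply: mulf_neq0 => //; apply: mulf_neq0.
pose K2 := arrows_witness R G A.
have K2L : forall i j, i \in A -> j \in A -> K2 i j = laplacian R G A i j.
  by move=> i j; apply: arrows_witness_like.
have gK2 : arrows_product K2 != 0.
  apply/prodf_neq0 => e /andP[ne ar]; exact: arrows_witness_neq0.
have [J2 [c2 [sJ2 D2 QJ2 gJ2 c2N]]] := locus_irreducible pQ2
  polyfun_arrows_product arrows_product_scale sJ1 D1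
  QJ1' (@arrows_witness_supported R _ G A) (like_laplacian_det K2L A0) gK2
  (like_laplacian_cofactor scA K2L).
move: QJ2; rewrite /Q2 mulf_eq0 negb_or => /andP[QJ2].
rewrite mulf_eq0 negb_or => /andP[g1J2 _].
pose g2 (J : 'M[R]_n) := g1 J * arrows_product J.
have sg2 (d : 'I_n -> R) (J : 'M[R]_n) :
    (forall i, d i != 0) -> g2 J != 0 -> g2 (scale_rows d J) != 0.
  move=> d0; rewrite /g2 mulf_eq0 negb_or => /andP[h1 h2].
  by apply: mulf_neq0; [apply: minors_product_scale|apply: arrows_product_scale].
have minors (J : 'M[R]_n) (T : {set 'I_n}) : g2 J != 0 ->
    p0 \notin T \/ T = [set: 'I_n]%SET -> \det (rowsel T J) != 0.
  rewrite /g2 /g1 !mulf_eq0 !negb_or => /andP[/andP[_ /prodf_neq0 H] _] HT.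
  by apply: H; case: HT => [->|->] //; rewrite eqxx orbT.
have [|J3 [sJ3 D3 QJ3 gJ3 hJ3]] := generic_hyperbolic (J := J2) (c := c2) (A := A)
  (G := G) pQ1 sg2 minors.
  by split=> //; apply: mulf_neq0.
move: gJ3; rewrite /g2 /g1 !mulf_eq0 !negb_or => /andP[/andP[N3 _] /prodf_neq0 ar3].
have Ja j l : j != l -> arrow G l j -> J3 j l != 0.
  by move=> jl lj; apply: (ar3 (j, l)); rewrite jl lj.
have [X [hyp fam nhom]] := linear_system_not_homeostatic sJ3 hJ3 Ja c2N N3.
apply: nhom; apply: (ind _ _ _ _ (linear_system_admissible c2 sJ3 Ja) hyp fam).
  by rewrite linear_system_jac; apply/(is_block_of_det _ ib).
by rewrite linear_system_jac linear_system_input_deriv; apply/eqP.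
Qed.

End NotInduced.

Local Close Scope ring_scope.

(** * Induction of super-simple and backbone nodes *)

Theorem theorem2p19 (R : realType) (n : nat) (G : network n)
    (A : {set 'I_n}) :
  core G -> appendage_subnetwork G A ->
  (forall j : nat, (j < nb_super_simple G)%N ->
     (induces R G (full_subnetwork G A) (rho G j) <->
      downstream (SuperSimple j) (Vmax G A))) /\
  (forall j : nat, (0 < j < nb_super_simple G)%N ->
     (induces_all R G (full_subnetwork G A) (structural_subnetwork G j) <->
      strictly_downstream (Backbone j) (Vmax G A))).
Proof.
move=> cG appA.
have apA := appendage_subnetwork_appendage appA.
have induces_rho j : (j < nb_super_simple G)%N ->
    induces R G (full_subnetwork G A) (rho G j) <-> downstream (SuperSimple j) (Vmax G A).
  move=> jq; have ssj := rho_super_simple jq.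
  apply: iff_trans (iff_sym (Vmax_le_separates cG apA jq)).
  split=> [ind a aA|sep]; last first.
    by apply: (separates_induces R cG appA ssj sep); left.
  by apply/negP => ao; apply: (not_separates_not_induces cG appA ssj aA ao ind).
split=> // -[//|i] /= iq1; have iq := ltnW iq1; have ssi := rho_super_simple iq.
have -> : strictly_downstream (Backbone i.+1) (Vmax G A) =
          downstream (SuperSimple i) (Vmax G A) by [].
split=> [ind|dw].
  by apply/(induces_rho i iq)/ind; constructor 1.
have sep := (Vmax_le_separates cG apA iq).1 dw.
move=> k Hk; apply: (separates_induces R cG appA ssi sep).
have after w : simple_subnetwork G i.+1 w -> avoids G (rho G i) w (out G).
  by case=> _ pw _; apply: prec_avoids_out.
case: Hk => [->|[/after ko|[apk _ [s [ps ks [w wk wL] _]]]]|->]; [by left|by right| |].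
  right; apply: avoids_trans (after w wL).
  move: wk; rewrite inE => /andP[kw _]; apply: avoids_restrict kw => //.
  by rewrite inE negbK; apply: ssi.
right; apply: prec_avoids_out => //; apply: rho_prec => //.
by rewrite ltnSn iq1.
Qed.
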